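(* Let $\mathfrak{C}>1$ be a constant and let $B\in\mathbb{C}^{N\times N}$ be a diagonal matrix with (a) $\|B\|,\|B^{-1}\|\le\mathfrak{C}$; (b) $\langle B^2B^*\rangle=0$; (c) $0\le\chi(B)\le1-1/\mathfrak{C}$. Then there exist constants $\mathfrak{C}_1,M>0$, depending only on $\mathfrak{C}$, and a $C^1$ map $[0,1]\ni t\mapsto\mathcal{B}_t\in\mathbb{C}^{N\times N}$ such that: (0) $\mathcal{B}_0=B$ and the spectral measure of $\mathcal{B}_1$ is supported on at most $M$ points; and for all $t\in[0,1]$: (i) $\mathcal{B}_t$ is a diagonal matrix; (ii) $\|\mathcal{B}_t\|\le\mathfrak{C}_1$ and $\|\mathcal{B}_t^{-1}\|\le\mathfrak{C}_1$; (iii) $\|\mathrm{d}\mathcal{B}_t/\mathrm{d}t\|\le\mathfrak{C}_1$; (iv) $\langle\mathcal{B}_t^2\mathcal{B}_t^*\rangle=0$; (v$'$) $\chi(\mathcal{B}_t)=\chi(B)$, i.e. $\langle\mathcal{B}_t^3\mathcal{B}_t^*\rangle-\chi(B)\langle|\mathcal{B}_t|^4\rangle=0$.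
   Context: For $B\in\mathbb{C}^{N\times N}$, $\langle B\rangle:=N^{-1}\mathrm{Tr}\,B$, $|B|:=\sqrt{B^*B}$, $\|\cdot\|$ is the operator norm, and $$\chi(B):=\frac{\langle B^3B^*\rangle}{\langle|B^2|^2\rangle}.$$ Condition (c) includes that $\chi(B)$ is real. The constants $\mathfrak{C}_1,M$ do not depend on $N$. *)

(* Defs.v *)
From HB Require Import structures.
From mathcomp Require Import all_boot all_order all_algebra.
From mathcomp Require Import spectral.
From mathcomp Require Import all_classical all_reals all_analysis.
From mathcomp Require Import complex.

Set Implicit Arguments.
Unset Strict Implicit.
Unset Printing Implicit Defensive.

Import Order.TTheory GRing.Theory Num.Theory.
Import numFieldNormedType.Exports.

Local Open Scope classical_set_scope.
Local Open Scope sesquilinear_scope.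
Local Open Scope complex_scope.
Local Open Scope ring_scope.

(* The usual topology of C, given by the distance |z - w|. *)
HB.instance Definition _ (R : realType) :=
  PseudoPointedMetric.copy R[i] (R[i] : numFieldType)^o.

(* The scalar field is C = R[i] for an arbitrary realType R.  The order of
   R[i] is the partial one: z <= w holds iff w - z is a nonnegative real. *)

Definition ntr (R : realType) (N : nat) (B : 'M[R[i]]_N) : R[i] :=
  N%:R^-1 * \tr B.

(* Square root of a positive semidefinite matrix A = U^* diag(d) U, with
   U unitary; spectralmx and spectral_diag are meaningful for normal A. *)
Definition sqrtmx (R : realType) (N : nat) (A : 'M[R[i]]_N) : 'M[R[i]]_N :=
  invmx (spectralmx A)
    *m diag_mx (map_mx sqrtC (spectral_diag A)) *m spectralmx A.

Definition absmx (R : realType) (N : nat) (B : 'M[R[i]]_N) : 'M[R[i]]_N :=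
  sqrtmx (B^t* *m B).

Definition chi (R : realType) (N : nat) (B : 'M[R[i]]_N) : R[i] :=
  ntr (B ^+ 3 *m B^t*) / ntr (absmx (B ^+ 2) ^+ 2).

Definition l2norm (R : realType) (N : nat) (x : 'cV[R[i]]_N) : R :=
  Num.sqrt (\sum_(i < N) Normc.normc (x i 0) ^+ 2).

Definition opnorm (R : realType) (N : nat) (B : 'M[R[i]]_N) : R :=
  sup [set l2norm (B *m x) | x in [set x | l2norm x <= 1]].

Definition borelC (R : realType) := g_sigma_algebraType (@open R[i]).

(* N^-1 times the sum of the Dirac masses at the eigenvalues of B, counted
   with multiplicity; meaningful for normal B, as spectral_diag is. *)
Definition spectral_measure (R : realType) (N : nat) (B : 'M[R[i]]_N) :
    {measure set (borelC R) -> \bar R} :=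
  let lambda (k : nat) : borelC R :=
    nth 0 [seq spectral_diag B 0 i | i <- enum 'I_N] k in
  mscale (N%:R^-1)%:nng (msum (fun k => \d_(lambda k)) N).

Definition supported_on_at_most (R : realType)
    (mu : {measure set (borelC R) -> \bar R}) (M : nat) : Prop :=
  exists2 S : seq R[i], (size S <= M)%N & mu (~` [set` S]) = 0%E.

(* dF is the derivative of F on the closed interval [0, 1] (one-sided at the
   endpoints) and is continuous there.  The real difference quotient is
   embedded in C, as matrices over C are topologized as a C-module. *)
Definition C1_on01 (R : realType) (N : nat) (F dF : R -> 'M[R[i]]_N) : Prop :=
  (forall t : R, t \in `[0, 1] ->
     ((s - t)^-1)%:C *: (F s - F t) @[s --> within `[0, 1] t^'] --> dF t)
  /\ {within `[0, 1], continuous dF}.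

(* Main.v *)
Require Import Defs.
From HB Require Import structures.
From mathcomp Require Import all_boot all_order all_algebra.
From mathcomp Require Import spectral.
From mathcomp Require Import all_classical all_reals all_analysis.
From mathcomp Require Import complex.
From mathcomp Require Import ring lra.
Import Order.TTheory GRing.Theory Num.Theory.
Import numFieldNormedType.Exports.
Local Open Scope classical_set_scope.
Local Open Scope sesquilinear_scope.
Local Open Scope complex_scope.
Local Open Scope ring_scope.

(* Write the eigenvalues as points [(x_k, y_k)] of an annulus.  The conditions
   (iv) and (v') say that four polynomials [phi _ i] of the plane have mean
   zero along these points.  Every eigenvalue is moved linearly to a nearby
   point of a fixed finite grid, and the four constraints are restored along
   the way by adding a combination, with four coefficients [p(t)], of the
   gradients of the [phi _ i] taken at the grid points; the final position of
   an eigenvalue then depends on its grid point only.  An implicit function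
   theorem with explicit constants provides [p(t)], as soon as the Gram matrix
   of these gradients is bounded below uniformly in [N] and in the points.

   For the lower bound, let [f = r^2 (l + q)] be a combination of the [phi _ i],
   with [l] linear and [q] quadratic.  As [chi < 1], the form [q] is indefinite
   or zero, and then all the critical points of [f] apart from the origin lie
   in an open half-plane [u . z > 0].  By compactness
   [n |grad f|^2 + r^2 (u . z) > 1 / n] on the annulus, with [n] independent of
   [f]; the second term has mean zero by (iv), so the mean of [|grad f|^2] is
   at least [1 / n^2]. *)

Set Implicit Arguments.
Unset Strict Implicit.
Unset Printing Implicit Defensive.

(** * The constraint functions have no degenerate direction *)

(** The value [chi = 1] is a genuine obstacle: there [r^2 y^2] is a combination of the [phi _ i]
    which is critical along the whole line [y = 0], so that opposite real eigenvalues satisfy all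
    constraints with a singular Gram matrix.

    The half-plane comes from writing [q] as a product [P S] of linear forms of equal norm and using
    [(P, S)] as coordinates. Let [F] be minus the cosine of the angle between the two forms,
    [Q = P^2 + S^2 + 2 F P S], [A = P^2 + 4 F P S + 3 S^2] and [C = 3 P^2 + 4 F P S + S^2]. A
    critical point of [r^2 (al P + be S + P S)] other than the origin satisfies [3 al Q = - S A] and
    [3 be Q = - P C] with [Q > 0], so [A > 0] controls the sign of [al S] and [C > 0] that of
    [be P]. As [A + C = 4 Q], these two inequalities cannot fail at the same point; that they fail
    at two different points is excluded by a cubic equation for the slope [S / P]. Hence one of them
    holds on the whole critical set. *)

Lemma cubic_roots_absurd (R : realFieldType) (F tau s1 s2 : R) :
  -1 < F -> F < 0 ->
  1 + 4 * F * s1 + 3 * s1 ^+ 2 <= 0 -> 3 + 4 * F * s2 + s2 ^+ 2 <= 0 ->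
  tau * (3 + 4 * F * s1 + s1 ^+ 2) = s1 * (1 + 4 * F * s1 + 3 * s1 ^+ 2) ->
  tau * (3 + 4 * F * s2 + s2 ^+ 2) = s2 * (1 + 4 * F * s2 + 3 * s2 ^+ 2) ->
  False.
Proof.
move=> F1 F0 A1 C2 e1 e2.
have s1p : 0 < s1 by nra.
have s2p : 0 < s2 by nra.
have s11 : s1 < 1 by nra.
have s21 : 1 < s2 by nra.
have C1 : 0 < 3 + 4 * F * s1 + s1 ^+ 2 by nra.
have tau0 : tau <= 0.
  rewrite -(pmulr_lle0 tau C1) mulrC mulrC e1; nra.
(* The two equations say that this cubic vanishes at [s1] in [(0, 1)] and at [s2 > 1]. The sign at
   [0] makes its third root nonpositive, the sign at [1] makes it greater than 1. *)
pose p s := s * (1 + 4 * F * s + 3 * s ^+ 2) - tau * (3 + 4 * F * s + s ^+ 2).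
have p0 : 0 <= p 0 by rewrite /p; nra.
have p1 : 0 < p 1 by rewrite /p; nra.
(* [p] is [(s - s1) (s - s2) (3 s - m)]; compare the values of [m] read off
   at [0] and at [1]. *)
have E : (s2 - s1) * (p 1 * (s1 * s2) - p 0 * ((1 - s1) * (1 - s2))) =
         (s2 - s1) * (3 * (1 - s1) * (1 - s2) * (s1 * s2)).
  have r1 : p s1 = 0 by rewrite /p e1 subrr.
  have r2 : p s2 = 0 by rewrite /p e2 subrr.
  have -> : (s2 - s1) * (p 1 * (s1 * s2) - p 0 * ((1 - s1) * (1 - s2))) =
     (s2 - s1) * (3 * (1 - s1) * (1 - s2) * (s1 * s2))
     - (s2 * (1 - s2) * p s1 - s1 * (1 - s1) * p s2).
    rewrite /p; ring.
  by rewrite r1 r2; ring.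
have {}E := mulfI (_ : s2 - s1 != 0) E.
have s12 : s2 - s1 != 0 by rewrite subr_eq0 gt_eqF //; lra.
move/(_ s12) in E.
have s1s2 : 0 < s1 * s2 by rewrite mulr_gt0.
have d : (1 - s1) * (1 - s2) < 0 by nra.
have : 0 < p 1 * (s1 * s2) by rewrite mulr_gt0.
have : p 0 * ((1 - s1) * (1 - s2)) <= 0 by nra.
have : 3 * (1 - s1) * (1 - s2) * (s1 * s2) < 0 by nra.
lra.
Qed.

(** The hypotheses say that the gradient of [r^2 h] vanishes. Euler's identity for the parts of
    degree 3 and 4 gives [3 h = - P S]. Pairing the gradient with [(p1, p2)] and [(s1, s2)] and
    inverting their Gram matrix, with entries [nu] and [ka], isolates [al] and [be]; the factor
    [r^2] disappears because [r^2 (nu^2 - ka^2)] is a quadratic form in [P] and [S]. *)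
Lemma crit_coef (R : realFieldType) (al be p1 p2 s1 s2 x y : R) :
  let P := p1 * x + p2 * y in let S := s1 * x + s2 * y in
  let h := al * P + be * S + P * S in
  let nu := p1 ^+ 2 + p2 ^+ 2 in let ka := p1 * s1 + p2 * s2 in
  s1 ^+ 2 + s2 ^+ 2 = nu ->
  0 < x ^+ 2 + y ^+ 2 ->
  2 * x * h + (x ^+ 2 + y ^+ 2) * ((al + S) * p1 + (be + P) * s1) = 0 ->
  2 * y * h + (x ^+ 2 + y ^+ 2) * ((al + S) * p2 + (be + P) * s2) = 0 ->
  3 * al * (nu * P ^+ 2 + nu * S ^+ 2 - 2 * ka * P * S) =
    - S * (nu * P ^+ 2 - 4 * ka * P * S + 3 * nu * S ^+ 2) /\
  3 * be * (nu * P ^+ 2 + nu * S ^+ 2 - 2 * ka * P * S) =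
    - P * (3 * nu * P ^+ 2 - 4 * ka * P * S + nu * S ^+ 2).
Proof.
move=> P S h nu ka sE r0 gx gy.
have h3 : 3 * h = - (P * S).
  apply: (mulfI (lt0r_neq0 r0)).
  have : x * 0 + y * 0 = 0 :> R by ring.
  rewrite -{1}gx -{1}gy => e.
  apply/eqP; rewrite -subr_eq0; apply/eqP; rewrite -[RHS]e /h /P /S; ring.
have g1 : 2 * P * h + (x ^+ 2 + y ^+ 2) * ((al + S) * nu + (be + P) * ka) = 0.
  have : p1 * 0 + p2 * 0 = 0 :> R by ring.
  by rewrite -{1}gx -{1}gy => e; rewrite -[RHS]e /nu /ka /P /S; ring.
have g2 : 2 * S * h + (x ^+ 2 + y ^+ 2) * ((al + S) * ka + (be + P) * nu) = 0.
  have : s1 * 0 + s2 * 0 = 0 :> R by ring.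
  by rewrite -{1}gx -{1}gy => e; rewrite -[RHS]e -sE /ka /P /S; ring.
have QE : nu * P ^+ 2 + nu * S ^+ 2 - 2 * ka * P * S =
          (x ^+ 2 + y ^+ 2) * (nu ^+ 2 - ka ^+ 2).
  have -> : nu * P ^+ 2 + nu * S ^+ 2 - 2 * ka * P * S =
    (s1 ^+ 2 + s2 ^+ 2) * P ^+ 2 + nu * S ^+ 2 - 2 * ka * P * S by rewrite sE.
  have -> : (x ^+ 2 + y ^+ 2) * (nu ^+ 2 - ka ^+ 2) =
    (x ^+ 2 + y ^+ 2) * (nu * (s1 ^+ 2 + s2 ^+ 2) - ka ^+ 2) by rewrite sE; ring.
  by rewrite /nu /ka /P /S; ring.
have t1 : 2 * h * (nu * P - ka * S)
    + (al + S) * (nu * P ^+ 2 + nu * S ^+ 2 - 2 * ka * P * S) = 0.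
  rewrite QE; have : nu * 0 - ka * 0 = 0 :> R by ring.
  by rewrite -{1}g1 -{1}g2 => e; rewrite -[RHS]e; ring.
have t2 : 2 * h * (nu * S - ka * P)
    + (be + P) * (nu * P ^+ 2 + nu * S ^+ 2 - 2 * ka * P * S) = 0.
  rewrite QE; have : nu * 0 - ka * 0 = 0 :> R by ring.
  by rewrite -{1}g2 -{1}g1 => e; rewrite -[RHS]e; ring.
clear QE g1 g2 gx gy sE r0; clearbody h; clearbody P S nu ka.
have {}t1 : 2 * (- (P * S)) * (nu * P - ka * S)
    + 3 * (al + S) * (nu * P ^+ 2 + nu * S ^+ 2 - 2 * ka * P * S) = 0.
  by rewrite -h3 -[RHS](mulr0 3) -t1; ring.
have {}t2 : 2 * (- (P * S)) * (nu * S - ka * P)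
    + 3 * (be + P) * (nu * P ^+ 2 + nu * S ^+ 2 - 2 * ka * P * S) = 0.
  by rewrite -h3 -[RHS](mulr0 3) -t2; ring.
split; apply/eqP; rewrite -subr_eq0; apply/eqP.
  by rewrite -[RHS]t1; ring.
by rewrite -[RHS]t2; ring.
Qed.

(** Dividing the two equations at a point expresses [al / be] through the slope [S / P] alone. Two
    critical points thus give two solutions of the same cubic equation, with the signs required by
    [cubic_roots_absurd]. *)
Lemma crit_two_absurd (R : realFieldType) (F al be P1 S1 P2 S2 : R) :
  -1 < F -> F < 1 ->
  3 * al * (P1 ^+ 2 + S1 ^+ 2 + 2 * F * P1 * S1) =
    - S1 * (P1 ^+ 2 + 4 * F * P1 * S1 + 3 * S1 ^+ 2) ->
  3 * be * (P1 ^+ 2 + S1 ^+ 2 + 2 * F * P1 * S1) =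
    - P1 * (3 * P1 ^+ 2 + 4 * F * P1 * S1 + S1 ^+ 2) ->
  3 * al * (P2 ^+ 2 + S2 ^+ 2 + 2 * F * P2 * S2) =
    - S2 * (P2 ^+ 2 + 4 * F * P2 * S2 + 3 * S2 ^+ 2) ->
  3 * be * (P2 ^+ 2 + S2 ^+ 2 + 2 * F * P2 * S2) =
    - P2 * (3 * P2 ^+ 2 + 4 * F * P2 * S2 + S2 ^+ 2) ->
  0 < P1 ^+ 2 + S1 ^+ 2 -> 0 < P2 ^+ 2 + S2 ^+ 2 ->
  P1 ^+ 2 + 4 * F * P1 * S1 + 3 * S1 ^+ 2 <= 0 ->
  3 * P2 ^+ 2 + 4 * F * P2 * S2 + S2 ^+ 2 <= 0 -> False.
Proof.
(* Changing the signs of [S1], [S2], [al] and [F] together preserves the hypotheses; for [F = 0] the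
   form at [(P1, S1)] is positive definite. *)
wlog F0 : F al S1 S2 / F < 0 => [wh|].
  move=> F1 F2 a1 b1 a2 b2 n1 n2 A1 C2.
  have [F0|F0|F0] := ltrgtP F 0; first exact: (wh F al S1 S2).
    by apply: (wh (- F) (- al) (- S1) (- S2)); rewrite ?sqrrN ?mulrN ?mulNr ?opprK;
      lra.
  rewrite F0 in A1 n1; nra.
move=> F1 _ a1 b1 a2 b2 n1 n2 A1 C2.
have P10 : P1 != 0.
  apply: contraTneq A1 => P10; rewrite P10 in n1 *; rewrite -ltNge; nra.
have P20 : P2 != 0.
  apply: contraTneq C2 => P20; rewrite P20 in n2 *; rewrite -ltNge; nra.
have dv (P S : R) : P != 0 ->
   (P ^+ 2 + S ^+ 2 + 2 * F * P * S = P ^+ 2 * (1 + (S/P)^+2 + 2 * F * (S/P))) *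
   (P ^+ 2 + 4 * F * P * S + 3 * S ^+ 2
      = P ^+ 2 * (1 + 4 * F * (S/P) + 3 * (S/P)^+2)) *
   (3 * P ^+ 2 + 4 * F * P * S + S ^+ 2
      = P ^+ 2 * (3 + 4 * F * (S/P) + (S/P)^+2)).
  by move=> P0; do !split; field.
rewrite !(dv _ _ P10) in a1 b1 A1; rewrite !(dv _ _ P20) in a2 b2 C2.
have P1p : 0 < P1 ^+ 2 by rewrite exprn_even_gt0.
have P2p : 0 < P2 ^+ 2 by rewrite exprn_even_gt0.
rewrite pmulr_rle0 // in A1; rewrite pmulr_rle0 // in C2.
have rpos (s : R) : 0 < 1 + s ^+ 2 + 2 * F * s.
  have : F ^+ 2 < 1 by nra.
  by have := sqr_ge0 (s + F); rewrite sqrrD; lra.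
(* If [be = 0], the form [3 P^2 + 4 F P S + S^2] vanishes at the first point; its sum with
   [P^2 + 4 F P S + 3 S^2] is four times a positive form, so the latter would be positive there. *)
have be0 : be != 0.
  apply: contraTneq A1 => be0; rewrite be0 mulr0 mul0r in b1.
  move/esym/eqP: b1; rewrite !mulf_eq0 oppr_eq0 !(negPf P10) /=.
  by move=> /eqP b1; rewrite -ltNge; move: (rpos (S1 / P1)) b1; lra.
have S1E : S1 = (S1 / P1) * P1 by rewrite mulfVK.
have S2E : S2 = (S2 / P2) * P2 by rewrite mulfVK.
set s1 := S1 / P1 in a1 b1 A1 S1E; set s2 := S2 / P2 in a2 b2 C2 S2E.
have key (P S s : R) : P != 0 -> S = s * P ->
  3 * al * (P ^+ 2 * (1 + s ^+ 2 + 2 * F * s)) =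
     - S * (P ^+ 2 * (1 + 4 * F * s + 3 * s ^+ 2)) ->
  3 * be * (P ^+ 2 * (1 + s ^+ 2 + 2 * F * s)) =
     - P * (P ^+ 2 * (3 + 4 * F * s + s ^+ 2)) ->
  al / be * (3 + 4 * F * s + s ^+ 2) = s * (1 + 4 * F * s + 3 * s ^+ 2).
  move=> P0 -> a b; have r := rpos s.
  apply: (mulfI be0); rewrite mulrA [be * _]mulrC mulfVK //.
  apply: (@mulfI _ (3 * (1 + s ^+ 2 + 2 * F * s) * P^+3)).
    by rewrite !mulf_neq0 ?expf_neq0 // ?pnatr_eq0 // (gt_eqF r).
  have -> : 3 * (1 + s ^+ 2 + 2 * F * s) * P ^+ 3 * (al * (3 + 4 * F * s + s ^+ 2))
    = (3 * al * (P ^+ 2 * (1 + s ^+ 2 + 2 * F * s))) * (P * (3 + 4 * F * s + s ^+ 2)) by ring.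
  have -> : 3 * (1 + s ^+ 2 + 2 * F * s) * P ^+ 3 * (be * (s * (1 + 4 * F * s + 3 * s ^+ 2)))
    = (3 * be * (P ^+ 2 * (1 + s ^+ 2 + 2 * F * s))) *
      (P * (s * (1 + 4 * F * s + 3 * s ^+ 2))) by ring.
  by rewrite a b; ring.
apply: (@cubic_roots_absurd R F (al / be) s1 s2) => //.
  exact: (key P1 S1).
exact: (key P2 S2).
Qed.

(* The witness is plus or minus [p] or [s]: along the critical points either
   [- al * S] or [- be * P] keeps a constant sign. *)
Lemma crit_half_plane_factored (R : realFieldType) (al be p1 p2 s1 s2 : R) :
  s1 ^+ 2 + s2 ^+ 2 = p1 ^+ 2 + p2 ^+ 2 -> p1 * s2 - p2 * s1 != 0 ->
  exists u1 u2 : R, forall x y : R, 0 < x ^+ 2 + y ^+ 2 ->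
    let P := p1 * x + p2 * y in let S := s1 * x + s2 * y in
    let h := al * P + be * S + P * S in
    2 * x * h + (x ^+ 2 + y ^+ 2) * ((al + S) * p1 + (be + P) * s1) = 0 ->
    2 * y * h + (x ^+ 2 + y ^+ 2) * ((al + S) * p2 + (be + P) * s2) = 0 ->
    0 < u1 * x + u2 * y.
Proof.
move=> sE dt.
pose nu := p1 ^+ 2 + p2 ^+ 2; pose ka := p1 * s1 + p2 * s2.
have dt2 : 0 < nu ^+ 2 - ka ^+ 2.
  have -> : nu ^+ 2 - ka ^+ 2 = (p1 * s2 - p2 * s1) ^+ 2.
    have -> : nu ^+ 2 = (p1 ^+ 2 + p2 ^+ 2) * (s1 ^+ 2 + s2 ^+ 2) by rewrite sE.
    by rewrite /ka; ring.
  by rewrite exprn_even_gt0.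
have nu0 : 0 < nu.
  rewrite lt_neqAle eq_sym addr_ge0 ?sqr_ge0 // andbT.
  by apply: contraTneq dt2 => ->; rewrite -leNgt; nra.
pose F := - (ka / nu).
have nuF : nu * F = - ka by rewrite /F mulrN mulrC mulfVK // gt_eqF.
have F2 : F ^+ 2 < 1.
  rewrite -(ltr_pM2l (exprn_gt0 2 nu0)) -exprMn nuF sqrrN; lra.
have F1 : -1 < F by nra.
have F1' : F < 1 by nra.
pose crit x y := let P := p1 * x + p2 * y in let S := s1 * x + s2 * y in
    let h := al * P + be * S + P * S in [/\ 0 < x ^+ 2 + y ^+ 2,
    2 * x * h + (x ^+ 2 + y ^+ 2) * ((al + S) * p1 + (be + P) * s1) = 0 &
    2 * y * h + (x ^+ 2 + y ^+ 2) * ((al + S) * p2 + (be + P) * s2) = 0].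
have critE x y : crit x y ->
  let P := p1 * x + p2 * y in let S := s1 * x + s2 * y in
  [/\ 0 < P ^+ 2 + S ^+ 2,
  3 * al * (P ^+ 2 + S ^+ 2 + 2 * F * P * S) =
    - S * (P ^+ 2 + 4 * F * P * S + 3 * S ^+ 2) &
  3 * be * (P ^+ 2 + S ^+ 2 + 2 * F * P * S) =
    - P * (3 * P ^+ 2 + 4 * F * P * S + S ^+ 2)].
  move=> [r0 gx gy] P S.
  have [c1 c2] := @crit_coef R al be p1 p2 s1 s2 x y sE r0 gx gy.
  split.
  - rewrite lt_neqAle eq_sym paddr_eq0 ?sqr_ge0 // addr_ge0 ?sqr_ge0 // andbT.
    rewrite !sqrf_eq0; apply: contraTN r0 => /andP[/eqP P0 /eqP S0].
    have x0 : (p1 * s2 - p2 * s1) * x = s2 * P - p2 * S by rewrite /P /S; ring.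
    have y0 : (p1 * s2 - p2 * s1) * y = p1 * S - s1 * P by rewrite /P /S; ring.
    move: x0 y0; rewrite P0 S0 !mulr0 subrr => /eqP + /eqP.
    rewrite !mulf_eq0 (negPf dt) /= => /eqP -> /eqP ->.
    by rewrite expr0n /= addr0 ltxx.
  - by apply: (mulfI (lt0r_neq0 nu0)); move: c1; rewrite -/nu -/ka -/P -/S -[ka]opprK -nuF; lra.
  - by apply: (mulfI (lt0r_neq0 nu0)); move: c2; rewrite -/nu -/ka -/P -/S -[ka]opprK -nuF; lra.
pose good x y := let P := p1 * x + p2 * y in let S := s1 * x + s2 * y in
  0 < P ^+ 2 + 4 * F * P * S + 3 * S ^+ 2.
pose good' x y := let P := p1 * x + p2 * y in let S := s1 * x + s2 * y in
  0 < 3 * P ^+ 2 + 4 * F * P * S + S ^+ 2.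
have rrpos (P S : R) : 0 < P ^+ 2 + S ^+ 2 -> 0 < P ^+ 2 + S ^+ 2 + 2 * F * P * S.
  move=> n; have [F0|F0] := leP 0 F.
    have := mulr_ge0 F0 (sqr_ge0 (P + S)).
    have : 0 < (1 - F) * (P ^+ 2 + S ^+ 2) by rewrite mulr_gt0 // subr_gt0.
    lra.
  have : 0 <= - F * (P - S) ^+ 2 by rewrite mulr_ge0 ?sqr_ge0 // oppr_ge0 ltW.
  have : 0 < (1 + F) * (P ^+ 2 + S ^+ 2) by rewrite mulr_gt0 // -ltrBlDl sub0r.
  lra.
have axis (A B : R) : 0 < B ^+ 2 -> 3 * A * B ^+ 2 = - B * (3 * B ^+ 2) ->
    0 < - A * B.
  move=> B0 e; have -> : A = - B by apply: (mulIf (lt0r_neq0 B0)); lra.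
  by rewrite opprK -expr2.
have sgn (A B rr g : R) : 0 < rr -> 0 < g -> A != 0 -> 3 * A * rr = - B * g ->
    0 < - A * B.
  move=> rr0 g0 A0 e; rewrite -(pmulr_lgt0 _ g0).
  have -> : - A * B * g = 3 * rr * A ^+ 2.
    have -> : 3 * rr * A ^+ 2 = A * (3 * A * rr) by ring.
    by rewrite e; ring.
  by rewrite mulr_gt0 ?exprn_even_gt0 // mulr_gt0.
have [[x0 [y0 [c0 b0]]]|allg] :
    (exists x y, crit x y /\ ~~ good x y) \/ (forall x y, crit x y -> good x y).
  have [?|n] := EM (exists x y, crit x y /\ ~~ good x y); [by left|right].
  move=> x y c; case g : (good x y) => //; case: n; exists x, y.
  by rewrite g.
(* One critical point violating [good] forces [good'] at all critical points. *)
- have {c0 b0} allg' x y : crit x y -> good' x y.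
    move=> c; case g : (good' x y) => //; exfalso.
    move/negbT: g; rewrite /good' -leNgt => g.
    move: b0; rewrite /good -leNgt => b0.
    have [n0 a0 e0] := critE _ _ c0.
    have [n a e] := critE _ _ c.
    exact: (@crit_two_absurd R F al be _ _ _ _ F1 F1' a0 e0 a e n0 n b0 g).
  (* For [be = 0] all critical points lie on the line [P = 0], where the other equation reduces to
     [al = - S]. *)
  have [be0|be0] := eqVneq be 0.
    exists (- al * s1), (- al * s2) => x y r0 P S h gx gy.
    have c : crit x y by split.
    have [n a e] := critE _ _ c; have g := allg' _ _ c.
    have P0 : P = 0.
      move: e; rewrite be0 mulr0 mul0r => /esym/eqP.
      by rewrite mulf_eq0 oppr_eq0 (gt_eqF g) orbF => /eqP.
    have -> : - al * s1 * x + - al * s2 * y = - al * S by rewrite /S; ring.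
    apply: axis; move: a n; rewrite -/P -/S P0 => a n; [lra|].
    by move: a; rewrite !(expr0n, mulr0, mul0r, add0r, addr0) /=; lra.
  exists (- be * p1), (- be * p2) => x y r0 P S h gx gy.
  have c : crit x y by split.
  have [n a e] := critE _ _ c; have g := allg' _ _ c.
  have -> : - be * p1 * x + - be * p2 * y = - be * P by rewrite /P; ring.
  exact: sgn _ _ _ _ (rrpos _ _ n) g be0 e.
- have [al0|al0] := eqVneq al 0.
    exists (- be * p1), (- be * p2) => x y r0 P S h gx gy.
    have c : crit x y by split.
    have [n a e] := critE _ _ c; have g := allg _ _ c.
    have S0 : S = 0.
      move: a; rewrite al0 mulr0 mul0r => /esym/eqP.
      by rewrite mulf_eq0 oppr_eq0 (gt_eqF g) orbF => /eqP.
    have -> : - be * p1 * x + - be * p2 * y = - be * P by rewrite /P; ring.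
    apply: axis; move: e n; rewrite -/P -/S S0 => e n; [lra|].
    by move: e; rewrite !(expr0n, mulr0, mul0r, add0r, addr0) /=; lra.
  exists (- al * s1), (- al * s2) => x y r0 P S h gx gy.
  have c : crit x y by split.
  have [n a e] := critE _ _ c; have g := allg _ _ c.
  have -> : - al * s1 * x + - al * s2 * y = - al * S by rewrite /S; ring.
  exact: sgn _ _ _ _ (rrpos _ _ n) g al0 a.
Qed.

(** An indefinite binary form splits into two independent linear factors: [y] is one of them if
    [a = 0], otherwise they come from the square root of the discriminant. Cramer's rule then
    expands [(l1, l2)] in the rescaled factors. *)
Lemma crit_half_plane (R : rcfType) (l1 l2 a b c : R) :
  0 < b ^+ 2 - a * c ->
  exists u1 u2 : R, forall x y : R, 0 < x ^+ 2 + y ^+ 2 ->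
    let h := l1 * x + l2 * y + (a * x ^+ 2 + 2 * b * x * y + c * y ^+ 2) in
    2 * x * h + (x ^+ 2 + y ^+ 2) * (l1 + 2 * a * x + 2 * b * y) = 0 ->
    2 * y * h + (x ^+ 2 + y ^+ 2) * (l2 + 2 * b * x + 2 * c * y) = 0 ->
    0 < u1 * x + u2 * y.
Proof.
move=> D0.
have [[[p1 p2] [s1 s2]] /= [qE dt]] : exists ps : (R * R) * (R * R),
    (forall x y, (ps.1.1 * x + ps.1.2 * y) * (ps.2.1 * x + ps.2.2 * y) =
      a * x ^+ 2 + 2 * b * x * y + c * y ^+ 2) /\
    ps.1.1 * ps.2.2 - ps.1.2 * ps.2.1 != 0.
  have [a0|a0] := eqVneq a 0.
    exists ((0, 1), (2 * b, c)) => /=; split; first by move=> x y; rewrite a0; ring.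
    rewrite a0 mul0r subr0 exprn_even_gt0 //= in D0.
    by rewrite mul0r sub0r mul1r oppr_eq0 mulf_neq0 ?pnatr_eq0.
  pose d := Num.sqrt (b ^+ 2 - a * c).
  have d2 : d ^+ 2 = b ^+ 2 - a * c by rewrite sqr_sqrtr // ltW.
  have d0 : 0 < d by rewrite sqrtr_gt0.
  exists ((1, (b - d) / a), (a, b + d)) => /=; split.
    move=> x y; have -> : c = (b ^+ 2 - d ^+ 2) / a by rewrite d2; field.
    by field.
  rewrite mulfVK //; have -> : 1 * (b + d) - (b - d) = 2 * d by ring.
  by rewrite mulf_neq0 ?pnatr_eq0 // gt_eqF.
have sq_pos (x y x' y' : R) : x * y' - y * x' != 0 -> 0 < x ^+ 2 + y ^+ 2.
  move=> d; rewrite lt_neqAle eq_sym addr_ge0 ?sqr_ge0 // andbT.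
  rewrite paddr_eq0 ?sqr_ge0 // !sqrf_eq0; apply: contraNN d => /andP[/eqP-> /eqP->].
  by rewrite !mul0r subrr.
have pp : 0 < p1 ^+ 2 + p2 ^+ 2 by exact: sq_pos dt.
have ss : 0 < s1 ^+ 2 + s2 ^+ 2.
  by apply: (sq_pos _ _ p1 p2); rewrite -oppr_eq0; move: dt; congr (_ != 0); ring.
(* [m] equalizes the Euclidean norms of the two linear factors. *)
pose m := Num.sqrt (Num.sqrt ((s1 ^+ 2 + s2 ^+ 2) / (p1 ^+ 2 + p2 ^+ 2))).
have m0 : 0 < m by rewrite !sqrtr_gt0 divr_gt0.
have m4 : m ^+ 4 = (s1 ^+ 2 + s2 ^+ 2) / (p1 ^+ 2 + p2 ^+ 2).
  rewrite (exprM m 2 2) /m !sqr_sqrtr ?sqrtr_ge0 //.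
  by rewrite divr_ge0 // ltW.
have mn : m != 0 by rewrite gt_eqF.
have inv (A B : R) : exists al be : R,
    A = al * (m * p1) + be * (s1 / m) /\ B = al * (m * p2) + be * (s2 / m).
  exists ((A * s2 - B * s1) / (p1 * s2 - p2 * s1) / m).
  exists ((p1 * B - p2 * A) / (p1 * s2 - p2 * s1) * m).
  by split; field; rewrite mn dt.
have [al [be [l1E l2E]]] := inv l1 l2.
have qx x y : 2 * a * x + 2 * b * y =
  s1 * (p1 * x + p2 * y) + p1 * (s1 * x + s2 * y).
  have e10 := qE 1 0; have e01 := qE 0 1; have e11 := qE 1 1.
  have ea : a = p1 * s1 by lra.
  have eb : 2 * b = p1 * s2 + p2 * s1 by lra.
  by rewrite eb ea; ring.
have qy x y : 2 * b * x + 2 * c * y =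
  s2 * (p1 * x + p2 * y) + p2 * (s1 * x + s2 * y).
  have e10 := qE 1 0; have e01 := qE 0 1; have e11 := qE 1 1.
  have ec : c = p2 * s2 by lra.
  have eb : 2 * b = p1 * s2 + p2 * s1 by lra.
  by rewrite eb ec; ring.
have [|| u1 [u2 hu]] :=
    @crit_half_plane_factored R al be (m * p1) (m * p2) (s1 / m) (s2 / m).
- apply: (mulfI (expf_neq0 2 mn)).
  have -> : m ^+ 2 * ((s1 / m) ^+ 2 + (s2 / m) ^+ 2) = s1 ^+ 2 + s2 ^+ 2 by field.
  have -> : m ^+ 2 * ((m * p1) ^+ 2 + (m * p2) ^+ 2) =
    m ^+ 4 * (p1 ^+ 2 + p2 ^+ 2) by ring.
  by rewrite m4 mulfVK // gt_eqF.
- by have -> : m * p1 * (s2 / m) - m * p2 * (s1 / m) = p1 * s2 - p2 * s1 by field.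
exists u1, u2 => x y r0 gx gy; apply: (hu x y r0).
- by move: gx; rewrite -[l1 + _ + _]addrA qx -qE l1E l2E => gx; rewrite -[RHS]gx; field.
- by move: gy; rewrite -[l2 + _ + _]addrA qy -qE l1E l2E => gy; rewrite -[RHS]gy; field.
Qed.

(** * Compactness and the uniform lower bound for the Gram matrix *)

(** Compactness is used twice in its near-covering form, over [u] and then over [z]. The witness [t]
    found at one [u0] is kept for all nearby [u], so the choice of [t] may be arbitrary in [u] and
    [T] may be any type. *)
Lemma compact_certificate (R : realType) (U Z : topologicalType) (T : Type)
    (A : set U) (B : set Z) (g : U * Z -> R) (w : T -> Z -> R) :
  compact A -> compact B -> continuous g -> (forall v, 0 <= g v) ->
  (forall t, continuous (w t)) ->
  (forall u, A u -> exists t, forall z, B z -> g (u, z) = 0 -> 0 < w t z) ->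
  exists n : nat, forall u, A u -> exists t, forall z, B z ->
    n.+1%:R^-1 < n.+1%:R * g (u, z) + w t z.
Proof.
move=> cA cB cg g0 cw cert.
pose P (n : nat) u := exists t, forall z, B z ->
    n.+1%:R^-1 < n.+1%:R * g (u, z) + w t z.
suff : \forall n \near \oo, A `<=` P n.
  by move=> [n _ /(_ n (leqnn n)) h]; exists n.
apply: (compact_near_coveringP A).1 => // u0 Au0.
have [t ht] := cert _ Au0.
pose Q (i : U * nat) z := i.2.+1%:R^-1 < i.2.+1%:R * g (i.1, z) + w t z.
suff : \forall i \near filter_prod (nbhs u0) \oo, B `<=` Q i.
  by apply: filterS => -[u n] h; exists t.
apply: (compact_near_coveringP B).1 => // z0 Bz0.
have [gz|gz] := eqVneq (g (u0, z0)) 0.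
  have w0 := ht _ Bz0 gz.
  have w2 : \forall z \near z0, w t z0 / 2 < w t z.
    by apply: (cvgr_gt _ (cw t z0)); lra.
  have n2 : \forall n \near \oo, n.+1%:R^-1 < w t z0 / 2.
    have w1 : 0 < w t z0 / 2 by lra.
    exact: (near_infty_natSinv_lt (PosNum w1)).
  near=> z i; rewrite /Q /=.
  apply: (@lt_le_trans _ _ (w t z0 / 2)).
    by near: i; exists (setT, [set n | n.+1%:R^-1 < w t z0 / 2]) => //=;
      [split => //; exact: filterT | case=> ? ? []].
  apply: (@le_trans _ _ (w t z)); first by apply: ltW; near: z.
  by rewrite lerDr mulr_ge0.
(* Off the zeros of [g] a large [n] compensates a negative [w]. The threshold makes the first term
   at least [2 - w t z0]: one unit pays for the variation of [w], the other for
   [n.+1%:R^-1 <= 1]. *)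
have gp : 0 < g (u0, z0) by rewrite lt_neqAle eq_sym gz g0.
have [[/= B1 B2] [nB1 nB2] hB] :
    \forall p \near (u0, z0), g (u0, z0) / 2 < g p.
  by apply: (cvgr_gt _ (cg (u0, z0))); lra.
have w2 : \forall z \near z0, w t z0 - 1 < w t z.
  by apply: (cvgr_gt _ (cw t z0)); lra.
have n2 : \forall n \near \oo, (2 - w t z0) / (g (u0, z0) / 2) <= n%:R.
  exact: nbhs_infty_ger.
near=> z i.
have : g (u0, z0) / 2 < g (i.1, z).
  apply: (hB (i.1, z)); split => /=; last by near: z.
  by near: i; exists (B1, setT) => //=; [split => //; exact: filterT | case=> ? ? []].
have : (2 - w t z0) / (g (u0, z0) / 2) <= i.2%:R.
  by near: i; exists (setT, [set n | (2 - w t z0) / (g (u0, z0) / 2) <= n%:R]) => //=;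
      [split => //; exact: filterT | case=> ? ? []].
have : w t z0 - 1 < w t z by near: z.
rewrite /Q ler_pdivrMr; last lra.
move: (g (i.1, z)) => G wz hn hG.
have : i.2.+1%:R^-1 <= 1 :> R by rewrite invf_le1 ?ltr0n // ler1n.
have : i.2%:R * (g (u0, z0) / 2) <= i.2.+1%:R * G.
  by apply: ler_pM => //; [lra | rewrite ler_nat | exact: ltW].
move: hn wz; move: (i.2%:R * _) (i.2.+1%:R * G) (i.2.+1%:R^-1) (w t z) => a b c d.
lra.
Unshelve. all: by end_near. Qed.

(* For [b = x + i y], the vector [phi chi x y] lists the real and imaginary
   parts of [b^2 b^*] and, up to a factor, of [b^3 b^* - chi |b|^4]. *)
Definition phi {R : realType} (chi x y : R) (i : 'I_4) : R :=
  [:: (x ^+ 2 + y ^+ 2) * x; (x ^+ 2 + y ^+ 2) * y;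
      (x ^+ 2 + y ^+ 2) * (x * y);
      (x ^+ 2 + y ^+ 2) * ((1 - chi) * x ^+ 2 - (1 + chi) * y ^+ 2)]`_i.

Definition phix {R : realType} (chi x y : R) (i : 'I_4) : R :=
  [:: 2 * x * x + (x ^+ 2 + y ^+ 2); 2 * x * y;
      2 * x * (x * y) + (x ^+ 2 + y ^+ 2) * y;
      2 * x * ((1 - chi) * x ^+ 2 - (1 + chi) * y ^+ 2)
        + (x ^+ 2 + y ^+ 2) * (2 * (1 - chi) * x)]`_i.

Definition phiy {R : realType} (chi x y : R) (i : 'I_4) : R :=
  [:: 2 * y * x; 2 * y * y + (x ^+ 2 + y ^+ 2);
      2 * y * (x * y) + (x ^+ 2 + y ^+ 2) * x;
      2 * y * ((1 - chi) * x ^+ 2 - (1 + chi) * y ^+ 2)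
        - (x ^+ 2 + y ^+ 2) * (2 * (1 + chi) * y)]`_i.

(** The factor [x ^+ 2 + y ^+ 2] in the conclusion turns it into a combination of [phi chi x y 0]
    and [phi chi x y 1], whose sums over the eigenvalues vanish. *)
Lemma phi_crit_half_plane (R : realType) (chi : R) (q : 'rV[R]_4) :
  0 <= chi < 1 -> q != 0 ->
  exists u : R * R, forall x y : R, 0 < x ^+ 2 + y ^+ 2 ->
    \sum_i q 0 i * phix chi x y i = 0 -> \sum_i q 0 i * phiy chi x y i = 0 ->
    0 < (u.1 * x + u.2 * y) * (x ^+ 2 + y ^+ 2).
Proof.
move=> /andP[chi0 chi1] q0.
pose q' (n : nat) : R := q 0 (inord n).
have SE (F : 'I_4 -> R) : \sum_i q 0 i * F i = q' 0 * F (inord 0)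
    + (q' 1 * F (inord 1) + (q' 2 * F (inord 2) + q' 3 * F (inord 3))).
  rewrite !big_ord_recl big_ord0 addr0 /q'.
  by congr (q 0 _ * F _ + (q 0 _ * F _ + (q 0 _ * F _ + q 0 _ * F _)));
    apply: val_inj; rewrite /= inordK.
(* Without quadratic part, [f = r^2 l] has no critical point off the origin: [x fx + y fy = 3 r^2 l]
   forces [l = 0], and then the gradient is [r^2] times that of [l]. *)
have [z|nz] := eqVneq (q' 2 ^+ 2 + q' 3 ^+ 2) 0.
  exists (0, 0) => x y r0; rewrite !SE /phix /phiy !inordK //=.
  move/eqP: z; rewrite paddr_eq0 ?sqr_ge0 // !sqrf_eq0 => /andP[/eqP q2 /eqP q3].
  rewrite q2 q3 !mul0r !addr0 => ex ey.
  have q01 : q' 0 * x + q' 1 * y = 0.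
    apply: (mulfI (lt0r_neq0 r0)); apply: (mulfI (_ : 3 != 0 :> R)).
      by rewrite pnatr_eq0.
    have : x * 0 + y * 0 = 0 :> R by ring.
    by rewrite -{1}ex -{1}ey => e; rewrite !mulr0 -[RHS]e; ring.
  have q00 : q' 0 = 0.
    apply: (mulfI (lt0r_neq0 r0)); rewrite mulr0 -[RHS]ex.
    have -> : q' 0 * (2 * x * x + (x ^+ 2 + y ^+ 2)) + q' 1 * (2 * x * y) =
     2 * x * (q' 0 * x + q' 1 * y) + (x ^+ 2 + y ^+ 2) * q' 0 by ring.
    by rewrite q01; ring.
  have q10 : q' 1 = 0.
    apply: (mulfI (lt0r_neq0 r0)); rewrite mulr0 -[RHS]ey.
    have -> : q' 0 * (2 * y * x) + q' 1 * (2 * y * y + (x ^+ 2 + y ^+ 2)) =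
     2 * y * (q' 0 * x + q' 1 * y) + (x ^+ 2 + y ^+ 2) * q' 1 by ring.
    by rewrite q01; ring.
  case/negP: q0; apply/eqP/rowP => i; rewrite mxE.
  have -> : q 0 i = q' i by rewrite /q'; congr (q 0 _); apply: val_inj; rewrite /= inordK.
  by case: i => -[|[|[|[|]]]].
(* The discriminant is [q' 2 ^+ 2 / 4 + (1 - chi ^+ 2) * q' 3 ^+ 2]; its positivity rests on
   [chi < 1]. *)
have D0 : 0 < (q' 2 / 2) ^+ 2 - (q' 3 * (1 - chi)) * (- (q' 3 * (1 + chi))).
  have c2 : 0 < 1 - chi ^+ 2 by nra.
  have -> : (q' 2 / 2) ^+ 2 - q' 3 * (1 - chi) * - (q' 3 * (1 + chi)) =
     q' 2 ^+ 2 / 4 + (1 - chi ^+ 2) * q' 3 ^+ 2 by field.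
  have [q30|q30] := eqVneq (q' 3) 0.
    move: nz; rewrite q30 expr0n /= mulr0 !addr0 => nz.
    by rewrite divr_gt0 // lt_neqAle eq_sym nz sqr_ge0.
  apply: ltr_wpDl; first by rewrite divr_ge0 ?sqr_ge0.
  by apply: mulr_gt0 => //; rewrite exprn_even_gt0.
have [u1 [u2 hu]] := @crit_half_plane R (q' 0) (q' 1) _ _ _ D0.
exists (u1, u2) => x y r0; rewrite !SE /phix /phiy !inordK //= => ex ey.
rewrite mulr_gt0 //; apply: (hu x y r0).
- by rewrite -[RHS]ex; field.
- by rewrite -[RHS]ey; field.
Qed.

Lemma continuous_add_fun {R : realType} (T : topologicalType) (f h : T -> R) :
  continuous f -> continuous h -> continuous (fun v => f v + h v).
Proof. by move=> cf ch v; exact: cvgD (cf v) (ch v). Qed.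

Lemma continuous_mul_fun {R : realType} (T : topologicalType) (f h : T -> R) :
  continuous f -> continuous h -> continuous (fun v => f v * h v).
Proof. by move=> cf ch v; exact: cvgM (cf v) (ch v). Qed.

Lemma continuous_opp_fun {R : realType} (T : topologicalType) (f : T -> R) :
  continuous f -> continuous (fun v => - f v).
Proof. by move=> cf v; exact: cvgN (cf v). Qed.

Lemma continuous_sqr_fun {R : realType} (T : topologicalType) (f : T -> R) :
  continuous f -> continuous (fun v => f v ^+ 2).
Proof. by move=> cf; under eq_fun do rewrite expr2; exact: continuous_mul_fun. Qed.

Ltac continuous_poly := lazymatch goal with
  | |- continuous (fun v => @?f v + @?h v) =>
      apply: (@continuous_add_fun _ _ f h); continuous_poly
  | |- continuous (fun v => @?f v * @?h v) =>
      apply: (@continuous_mul_fun _ _ f h); continuous_poly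
  | |- continuous (fun v => - (@?f v)) =>
      apply: (@continuous_opp_fun _ _ f); continuous_poly
  | |- continuous (fun v => (@?f v) ^+ 2) =>
      apply: (@continuous_sqr_fun _ _ f); continuous_poly
  | |- continuous (fun _ => ?c) => move=> ?; exact: cvg_cst
  | |- _ => assumption
  end.

(** [chi] belongs to the compact parameter set together with the normalized [q]. Keeping it at
    distance [K^-1] from 1 is what makes [eta] depend on [K] only. *)
Lemma phi_gram_coercive (R : realType) (K : R) : 1 < K ->
  exists2 eta : R, 0 < eta &
  forall (chi : R), 0 <= chi <= 1 - K^-1 ->
  forall (N : nat) (x y : 'I_N -> R),
    (forall k, (K ^+ 2)^-1 <= x k ^+ 2 + y k ^+ 2 <= K ^+ 2) ->
    (forall i, \sum_k phi chi (x k) (y k) i = 0) ->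
    forall q : 'rV[R]_4, eta * `|q| ^+ 2 * N%:R <=
      \sum_k ((\sum_i q 0 i * phix chi (x k) (y k) i) ^+ 2 +
              (\sum_i q 0 i * phiy chi (x k) (y k) i) ^+ 2).
Proof.
move=> K1.
have K0 : 0 < K by lra.
pose A : set ('rV[R]_4 * R) := [set q | `|q| = 1] `*` `[0, 1 - K^-1].
pose B : set (R * R) := [set z | (K ^+ 2)^-1 <= z.1 ^+ 2 + z.2 ^+ 2 <= K ^+ 2].
pose g (v : ('rV[R]_4 * R) * (R * R)) : R :=
  (\sum_i v.1.1 0 i * phix v.1.2 v.2.1 v.2.2 i) ^+ 2 +
  (\sum_i v.1.1 0 i * phiy v.1.2 v.2.1 v.2.2 i) ^+ 2.
pose w (t : R * R) (z : R * R) : R := (t.1 * z.1 + t.2 * z.2) * (z.1 ^+ 2 + z.2 ^+ 2).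
have cA : compact A.
  apply: compact_setX; last exact: segment_compact.
  apply: bounded_closed_compact.
    by exists 1; split => // M M1 q /= ->; exact: ltW.
  apply: (@closed_comp _ _ (fun q : 'rV[R]_4 => `|q|) [set x | x = 1]).
    by move=> q _; exact: norm_continuous.
  exact: closed_eq.
have x1c : continuous (fun z : R * R => z.1) by move=> z; exact: cvg_fst.
have x2c : continuous (fun z : R * R => z.2) by move=> z; exact: cvg_snd.
have cB : compact B.
  have cQ : compact (`[(-K), K]%classic `*` `[(-K), K]%classic : set (R * R)).
    by apply: compact_setX; exact: segment_compact.
  apply: (subclosed_compact _ cQ).
    apply: (@closed_comp _ _ (fun z : R * R => z.1 ^+ 2 + z.2 ^+ 2)
       `[(K ^+ 2)^-1, K ^+ 2]%classic).
      move=> z _; have : continuous (fun z : R * R => z.1 ^+ 2 + z.2 ^+ 2); last exact.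
      by continuous_poly.
    exact: itv_closed.
  move=> [x y] /andP[_ /= h]; split; rewrite /= in_itv /=; nra.
have cg : continuous g.
  have cq i : continuous (fun v : ('rV[R]_4 * R) * (R * R) => v.1.1 0 i).
    move=> v; apply: (@continuous_comp _ _ _ (fun v : ('rV[R]_4 * R) * (R * R) => v.1.1)
      (fun q => q 0 i)); last exact: coord_continuous.
    by apply: (@continuous_comp _ _ _ fst fst); exact: cvg_fst.
  have cc : continuous (fun v : ('rV[R]_4 * R) * (R * R) => v.1.2).
    move=> v; apply: (@continuous_comp _ _ _ fst snd); [exact: cvg_fst|exact: cvg_snd].
  have cx : continuous (fun v : ('rV[R]_4 * R) * (R * R) => v.2.1).
    move=> v; apply: (@continuous_comp _ _ _ snd fst); [exact: cvg_snd|exact: cvg_fst].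
  have cy : continuous (fun v : ('rV[R]_4 * R) * (R * R) => v.2.2).
    move=> v; apply: (@continuous_comp _ _ _ snd snd); exact: cvg_snd.
  apply: continuous_add_fun; apply: continuous_sqr_fun;
      apply: continuous_big => [|i _]; try exact: add_continuous.
    apply: continuous_mul_fun; first exact: cq.
    by case: i => -[|[|[|[|]]]] //= ?; rewrite /phix /=; continuous_poly.
  apply: continuous_mul_fun; first exact: cq.
  by case: i => -[|[|[|[|]]]] //= ?; rewrite /phiy /=; continuous_poly.
have cw t : continuous (w t) by rewrite /w; continuous_poly.
have g0 v : 0 <= g v by rewrite addr_ge0 ?sqr_ge0.
have [|n hn] := @compact_certificate R _ _ _ A B g w cA cB cg g0 cw.
  move=> [q chi] [/= q1 chi01].
  have chi1 : 0 <= chi < 1.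
    move: chi01; rewrite in_itv /= => /andP[-> /= h]; apply: le_lt_trans h _.
    by rewrite ltrBlDr ltrDl invr_gt0.
  have [|u hu] := @phi_crit_half_plane R chi q chi1.
    by apply: contra_eq_neq q1 => ->; rewrite normr0 eq_sym oner_eq0.
  exists u => -[x y] /andP[/= r0 _] /eqP.
  rewrite paddr_eq0 ?sqr_ge0 // !sqrf_eq0 => /andP[/eqP ex /eqP ey].
  apply: hu => //; apply: lt_le_trans r0; by rewrite invr_gt0 exprn_gt0.
exists (n.+1%:R ^- 2); first by rewrite invr_gt0 exprn_gt0.
move=> chi chi01 N x y ann mom q.
have [->|q0] := eqVneq q 0.
  by rewrite normr0 expr0n /= mulr0 mul0r sumr_ge0 // => k _; rewrite addr_ge0 ?sqr_ge0.
have nq : 0 < `|q| by rewrite normr_gt0.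
have [|u hu] := hn (`|q|^-1 *: q, chi).
  by split; rewrite /= ?in_itv //= normrZ normfV normr_id mulVf // gt_eqF.
pose S k := (\sum_i q 0 i * phix chi (x k) (y k) i) ^+ 2 +
              (\sum_i q 0 i * phiy chi (x k) (y k) i) ^+ 2.
have gE k : g ((`|q|^-1 *: q, chi), (x k, y k)) = `|q| ^- 2 * S k.
  have sc F : \sum_(i < 4) (`|q|^-1 *: q) 0 i * F i = `|q|^-1 * \sum_(i < 4) q 0 i * F i.
    by rewrite mulr_sumr; apply: eq_bigr => i _; rewrite mxE mulrA.
  by rewrite /g /= !sc /S; field; rewrite gt_eqF.
have wE : \sum_k w u (x k, y k) = 0.
  transitivity (u.1 * (\sum_k phi chi (x k) (y k) 0)
    + u.2 * (\sum_k phi chi (x k) (y k) 1)); last by rewrite !mom; ring.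
  rewrite !mulr_sumr -big_split; apply: eq_bigr => k _ /=.
  rewrite /phi /=.
  by rewrite /w /=; ring.
have : \sum_(k < N) n.+1%:R^-1 <= \sum_k (n.+1%:R * (`|q| ^- 2 * S k) + w u (x k, y k)).
  by apply: ler_sum => k _; rewrite -gE; apply: ltW; apply: hu; exact: ann.
rewrite big_split /= wE addr0 sumr_const card_ord -mulr_sumr -mulr_sumr -/S.
have n0 : 0 < n.+1%:R :> R by rewrite ltr0n.
move: (\sum_k S k) n0 => T; move: (n.+1%:R) => m m0; rewrite -[_ *+ N]mulr_natr => h.
have m1 : 0 < m^-1 * `|q| ^+ 2 by rewrite mulr_gt0 ?exprn_gt0 ?invr_gt0.
rewrite -(ler_pM2l m1) in h; apply: le_trans (le_trans h _).
  by rewrite le_eqVlt; apply/orP; left; apply/eqP; field; rewrite gt_eqF.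
by rewrite le_eqVlt; apply/orP; left; apply/eqP; field; rewrite !gt_eqF.
Qed.

(** * A quantitative implicit function theorem *)

Definition ift_dom {R : realType} {n : nat} (del t : R) (p : 'rV[R]_n) :=
  (0 <= t <= 1) && (`|p| <= del).

(** [D] and [m] play the role of the derivatives of [H] in [p] and in [t], with row vectors
    multiplied by [D] on the right. The bounds hold on the whole product of [[0, 1]] and a ball,
    which gives a solution up to time 1 with explicit constants. [ift_small] keeps the minimizers of
    [|H t|] off the boundary of the ball. *)
Record ift_data {R : realType} {n : nat} (eta C del : R)
    (H m : R -> 'rV[R]_n -> 'rV[R]_n) (D : R -> 'rV[R]_n -> 'M[R]_n) : Prop := {
  ift_taylor : forall s t p p', ift_dom del s p' -> ift_dom del t p ->
     `|H s p' - H t p - (p' - p) *m D t p - (s - t) *: m t p|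
       <= C * (`|s - t| + `|p' - p|) ^+ 2;
  ift_coercive : forall t p (q : 'rV[R]_n), ift_dom del t p ->
     eta * `|q| <= `|q *m D t p|;
  ift_D_bounded : forall t p (q : 'rV[R]_n), ift_dom del t p ->
     `|q *m D t p| <= C * `|q|;
  ift_D_lip : forall s t p p' (q : 'rV[R]_n),
     ift_dom del s p' -> ift_dom del t p ->
     `|q *m D s p' - q *m D t p| <= C * (`|s - t| + `|p' - p|) * `|q|;
  ift_m_bounded : forall t p, ift_dom del t p -> `|m t p| <= C;
  ift_m_lip : forall s t p p', ift_dom del s p' -> ift_dom del t p ->
     `|m s p' - m t p| <= C * (`|s - t| + `|p' - p|);
  ift_start : H 0 0 = 0;
  ift_small : forall t, 0 <= t <= 1 -> `|H t 0| < eta * del / 4 }.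

(** As [|p' - p| <= 2 del] and [4 C del <= eta], the Taylor remainder is at most half of the
    coercive linear term. The inequality yields uniqueness of the zero and its Lipschitz dependence
    on time. *)
Lemma ift_lower (R : realType) (n : nat) (eta C del : R)
    (H m : R -> 'rV[R]_n -> 'rV[R]_n) (D : R -> 'rV[R]_n -> 'M[R]_n)  (t : R) (p p' : 'rV[R]_n) :
    0 < eta -> 0 < C -> 0 < del -> 4 * C * del <= eta ->
    ift_data eta C del H m D ->
  ift_dom del t p -> ift_dom del t p' ->
  eta / 2 * `|p' - p| <= `|H t p' - H t p|.
Proof.
move=> eta0 C0 del0 etaCdel I.
move=> dp dp'.
have := ift_taylor I dp' dp.
rewrite subrr scale0r subr0 normr0 add0r => T.
have c := ift_coercive I (p' - p) dp.
have dl : `|p' - p| <= 2 * del.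
  apply: le_trans (ler_normB _ _) _.
  by move: dp dp' => /andP[_ +] /andP[_ +]; lra.
have q2 : C * `|p' - p| ^+ 2 <= eta / 2 * `|p' - p|.
  rewrite expr2 mulrA ler_wpM2r //.
  apply: le_trans (_ : C * (2 * del) <= _); first by rewrite ler_pM2l.
  lra.
have : `|(p' - p) *m D t p| <= `|H t p' - H t p| + `|H t p' - H t p - (p' - p) *m D t p|.
  by rewrite -{1}[_ *m _](subKr (H t p' - H t p)) ler_normB.
lra.
Qed.

Lemma ift_unit (R : realType) (n : nat) (eta C del : R)
    (H m : R -> 'rV[R]_n -> 'rV[R]_n) (D : R -> 'rV[R]_n -> 'M[R]_n)  (t : R) (p : 'rV[R]_n) :
    0 < eta -> 0 < C -> 0 < del -> 4 * C * del <= eta ->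
    ift_data eta C del H m D ->
  ift_dom del t p -> D t p \in unitmx.
Proof.
move=> eta0 C0 del0 etaCdel I.
move=> d; rewrite -row_free_unit; apply: inj_row_free => v v0.
have := ift_coercive I v d; rewrite v0 normr0 => h.
by apply/eqP; rewrite -normr_le0 -(ler_pM2l eta0) mulr0.
Qed.

(** A minimizer of [|H t|] on the closed ball is a zero: at an interior point with nonzero value, a
    short step in Newton's direction multiplies [H t] by [1 - e] up to second order. This descent
    works for the sup norm, although that norm is not differentiable. *)
Lemma ift_exists (R : realType) (n : nat) (eta C del : R)
    (H m : R -> 'rV[R]_n -> 'rV[R]_n) (D : R -> 'rV[R]_n -> 'M[R]_n)  (t : R) :
    0 < eta -> 0 < C -> 0 < del -> 4 * C * del <= eta ->
    ift_data eta C del H m D ->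
  0 <= t <= 1 -> exists2 p, `|p| <= del & H t p = 0.
Proof.
move=> eta0 C0 del0 etaCdel I.
move=> t01.
pose A := [set p : 'rV[R]_n | `|p| <= del].
have cA : compact A.
  apply: bounded_closed_compact.
    by exists del; split => [|M M1 q /= h]; [exact: gtr0_real|apply: le_trans h (ltW M1)].
  apply: (@closed_comp _ _ (fun q : 'rV[R]_n => `|q|) [set x | x <= del]).
    by move=> q _; exact: norm_continuous.
  exact: closed_le.
have domA p : A p -> ift_dom del t p by move=> Ap; apply/andP; split.
have cf : {within A, continuous (fun p => `|H t p|)}.
  apply/subspace_continuousP => p Ap.
  apply: cvg_norm; apply/cvgrPdist_lt => e e0.
  have L0 : 0 < C * (1 + 2 * del) by rewrite mulr_gt0 // addr_gt0 // mulr_gt0.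
  have nb : \forall x \near p, `|p - x| < e / (C * (1 + 2 * del)).
    by apply: (@cvgr_dist_lt _ _ _ (nbhs p) _ id p cvg_id); exact: divr_gt0.
  near=> p'.
  have Ap' : A p' by near: p'; exact: withinT.
  have pp' : `|p - p'| < e / (C * (1 + 2 * del)).
    by near: p'; apply: (cvg_within _ nb).
  have := ift_taylor I (@domA _ Ap) (@domA _ Ap').
  rewrite subrr scale0r subr0 normr0 add0r => T.
  have b := ift_D_bounded I (p - p') (@domA _ Ap').
  have tr : `|H t p - H t p'| <= `|(p - p') *m D t p'| +
      `|H t p - H t p' - (p - p') *m D t p'|.
    rewrite -{1}(subrK ((p - p') *m D t p') (H t p - H t p')) addrC; exact: ler_normD.
  have dl : `|p - p'| <= 2 * del.
    by apply: le_trans (ler_normB _ _) _; move: Ap Ap'; rewrite /A /=; lra.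
  apply: le_lt_trans tr _.
  apply: le_lt_trans (_ : `|p - p'| * (C * (1 + 2 * del)) < e).
    have : C * `|p - p'| ^+ 2 <= C * (2 * del * `|p - p'|).
      by rewrite ler_pM2l // expr2 ler_wpM2r.
    lra.
  by rewrite -ltr_pdivlMr.
have A0 : A !=set0 by exists 0; rewrite /A /= normr0 ltW.
have [p /set_mem Ap pmin] := EVT_min_rV A0 cA cf.
exists p => //; apply/eqP/negPn/negP => h0.
(* On the boundary, [eta / 2 * del <= |H t p| + |H t 0| <= 2 |H t 0|] would contradict
   [ift_small]. *)
have pd : `|p| < del.
  rewrite lt_neqAle Ap andbT; apply/eqP => pdel.
  have A00 : A 0 by rewrite /A /= normr0 ltW.
  have := ift_lower eta0 C0 del0 etaCdel I (@domA _ A00) (@domA _ Ap).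
  have := pmin _ (mem_set A00).
  have := ift_small I t01.
  have := ler_normB (H t p) (H t 0).
  rewrite subr0 pdel; lra.
have du := ift_unit eta0 C0 del0 etaCdel I (@domA _ Ap).
pose q := - (H t p *m invmx (D t p)).
have qD : q *m D t p = - H t p by rewrite mulNmx -mulmxA mulVmx // mulmx1.
have hp : 0 < `|H t p| by rewrite normr_gt0.
(* The three bounds keep [1 - e] nonnegative, the new point in the ball, and the second-order error
   at most half of the gain [e * |H t p|]. *)
pose e := Num.min 1 (Num.min ((del - `|p|) / (1 + `|q|)) (`|H t p| / (2 * C * (1 + `|q|) ^+ 2))).
have q1 : 0 < 1 + `|q| by rewrite ltr_wpDr.
have e0 : 0 < e.
  rewrite !lt_min ltr01 /= !divr_gt0 ?subr_gt0 //.
  by rewrite !mulr_gt0 // exprn_gt0.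
have e1 : e <= 1 by rewrite ge_min lexx.
have e2 : e * (1 + `|q|) <= del - `|p|.
  by rewrite -ler_pdivlMr // !ge_min lexx orbT.
have e3 : e * (2 * C * (1 + `|q|) ^+ 2) <= `|H t p|.
  rewrite -ler_pdivlMr ?mulr_gt0 ?exprn_gt0 //.
  by rewrite !ge_min lexx !orbT.
have Ae : A (p + e *: q).
  rewrite /A /=; apply: le_trans (ler_normD _ _) _.
  rewrite normrZ gtr0_norm //; nra.
have := pmin _ (mem_set Ae); apply/negP; rewrite -ltNge.
have := ift_taylor I (@domA _ Ae) (@domA _ Ap).
rewrite subrr scale0r subr0 normr0 add0r.
have -> : p + e *: q - p = e *: q by rewrite addrC addKr.
rewrite -scalemxAl qD normrZ gtr0_norm // => T.
have tr : `|H t (p + e *: q)| <= (1 - e) * `|H t p| +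
     `|H t (p + e *: q) - H t p - e *: - H t p|.
  have -> : (1 - e) * `|H t p| = `|(1 - e) *: H t p|.
    by rewrite normrZ ger0_norm // subr_ge0.
  apply: le_trans (ler_normD _ _); rewrite le_eqVlt; apply/orP; left; apply/eqP.
  rewrite -scalerN opprK scalerBl scale1r; move: (H t (p + _)) (e *: H t p) (H t p) => X h2 h1.
  by congr (`|_|); apply/rowP => i; rewrite !mxE; ring.
apply: le_lt_trans tr _.
have q2 : `|q| ^+ 2 <= (1 + `|q|) ^+ 2 by have := normr_ge0 q; nra.
have : C * (e * `|q|) ^+ 2 <= e * `|H t p| / 2.
  have -> : C * (e * `|q|) ^+ 2 = e * (e * (C * `|q| ^+ 2)) by ring.
  rewrite -mulrA ler_pM2l //.
  have : e * (C * `|q| ^+ 2) <= e * (C * (1 + `|q|) ^+ 2) by rewrite ler_pM2l // ler_pM2l.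
  lra.
have : 0 < e * `|H t p| by rewrite mulr_gt0.
lra.
Unshelve. all: by end_near. Qed.

(** [C1] is chosen before [n], [del] and the data, so it depends on [eta] and [C] alone. By
    [ift_lower] any selection of zeros is Lipschitz in time, and [dp] is its derivative by implicit
    differentiation. *)
Lemma quantitative_ift (R : realType) (eta C : R) :
  0 < eta -> 0 < C -> exists2 C1 : R, 0 < C1 &
  forall (n : nat) (del : R)
    (H m : R -> 'rV[R]_n -> 'rV[R]_n) (D : R -> 'rV[R]_n -> 'M[R]_n),
    0 < del -> 4 * C * del <= eta -> ift_data eta C del H m D ->
    exists p dp : R -> 'rV[R]_n, p 0 = 0 /\
      forall s t, 0 <= s <= 1 -> 0 <= t <= 1 ->
      [/\ `|p t| <= del, H t (p t) = 0, `|dp t| <= C1,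
          `|p s - p t - (s - t) *: dp t| <= C1 * `|s - t| ^+ 2 &
          `|dp s - dp t| <= C1 * `|s - t| ].
Proof.
(* [L] is a Lipschitz constant of [p]; [a] bounds [dp], [b] the second-order remainder of [p], and
   [c] is a Lipschitz constant of [dp]. *)
move=> eta0 C0; pose L := 4 * C / eta.
have L0 : 0 < L by rewrite divr_gt0 // mulr_gt0.
pose a := C / eta; pose b := C * (1 + L) ^+ 2 / eta.
pose c := C * (1 + L) * (1 + C / eta) / eta.
have a0 : 0 < a by rewrite divr_gt0.
have L1 : 0 < 1 + L by rewrite addr_gt0.
have b0 : 0 < b by rewrite divr_gt0 // mulr_gt0 // exprn_gt0.
have c0 : 0 < c by rewrite divr_gt0 // !mulr_gt0 // addr_gt0.
exists (a + b + c); first by rewrite !addr_gt0.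
move=> n del H m D del0 etaCdel I.
have /choice[p hp] t : exists p : 'rV[R]_n,
    0 <= t <= 1 -> `|p| <= del /\ H t p = 0.
  have [t01|nt] := boolP (0 <= t <= 1); last by exists 0.
  by have [p] := ift_exists eta0 C0 del0 etaCdel I t01; exists p.
have dom t : 0 <= t <= 1 -> ift_dom del t (p t).
  by move=> t01; rewrite /ift_dom t01 (hp _ t01).1.
pose dp t := - (m t (p t) *m invmx (D t (p t))).
have dpD t : 0 <= t <= 1 -> dp t *m D t (p t) = - m t (p t).
  move=> t01; rewrite mulNmx -mulmxA mulVmx ?mulmx1 //.
  exact: ift_unit eta0 C0 del0 etaCdel I (dom _ t01).
have dpC t : 0 <= t <= 1 -> `|dp t| <= a.
  move=> t01; rewrite ler_pdivlMr // mulrC.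
  apply: le_trans (ift_coercive I _ (dom _ t01)) _.
  by rewrite dpD // normrN (ift_m_bounded I (dom _ t01)).
have pL s t : 0 <= s <= 1 -> 0 <= t <= 1 -> `|p s - p t| <= L * `|s - t|.
  move=> s01 t01.
  (* Both zeros are compared at time [s], where [H s (p t)] is of order [|s - t|] by the Taylor
     bound. *)
  have domst : ift_dom del s (p t) by rewrite /ift_dom s01 (hp _ t01).1.
  have := ift_lower eta0 C0 del0 etaCdel I domst (dom _ s01).
  rewrite (hp _ s01).2 sub0r normrN => lo.
  have := ift_taylor I domst (dom _ t01).
  rewrite (hp _ t01).2 subr0 subrr mul0mx subr0 normr0 addr0 => T.
  have mb := ift_m_bounded I (dom _ t01).
  have st1 : `|s - t| <= 1 by rewrite ler_norml; move: s01 t01; lra.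
  have up : `|H s (p t)| <= 2 * C * `|s - t|.
    rewrite -[H s (p t)](subrK ((s - t) *: m t (p t))).
    apply: le_trans (ler_normD _ _) _; rewrite normrZ.
    have : C * `|s - t| ^+ 2 <= C * `|s - t|.
      by rewrite ler_pM2l // expr2 ler_piMr.
    have : `|s - t| * `|m t (p t)| <= `|s - t| * C by rewrite ler_wpM2l.
    lra.
  rewrite /L mulrAC ler_pdivlMr //; lra.
exists p, dp; split.
  have z01 : 0 <= (0 : R) <= 1 by rewrite lexx ler01.
  have dom00 : ift_dom del 0 (0 : 'rV[R]_n) by rewrite /ift_dom z01 normr0 ltW.
  have := ift_lower eta0 C0 del0 etaCdel I dom00 (dom _ z01).
  rewrite (hp _ z01).2 (ift_start I) !subr0 normr0 pmulr_rle0 ?divr_gt0 //.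
  by rewrite normr_le0 => /eqP.
move=> s t s01 t01; have [pd p0] := hp _ t01; split => //.
- by apply: le_trans (dpC _ t01) _; lra.
- apply: le_trans (_ : b * `|s - t| ^+ 2 <= _); last first.
    by rewrite ler_wpM2r ?exprn_ge0 //; lra.
  rewrite mulrAC ler_pdivlMr // mulrC.
  apply: le_trans (ift_coercive I _ (dom _ t01)) _.
  rewrite mulmxBl -scalemxAl dpD // scalerN opprK.
  have := ift_taylor I (dom _ s01) (dom _ t01).
  rewrite (hp _ s01).2 p0 subrr sub0r -opprD normrN => T.
  apply: le_trans T _; rewrite -mulrA ler_pM2l //.
  rewrite -exprMn lerXn2r ?nnegrE ?addr_ge0 ?mulr_ge0 //; first exact: ltW.
  by rewrite mulrDl mul1r lerD2l pL.
- apply: le_trans (_ : c * `|s - t| <= _); last first.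
    by rewrite ler_wpM2r //; lra.
  rewrite mulrAC ler_pdivlMr // mulrC.
  apply: le_trans (ift_coercive I _ (dom _ s01)) _.
  have -> : (dp s - dp t) *m D s (p s) =
      - (m s (p s) - m t (p t)) - (dp t *m D s (p s) - dp t *m D t (p t)).
    by rewrite mulmxBl !dpD //; apply/rowP => i; rewrite !mxE; ring.
  apply: le_trans (ler_normB _ _) _; rewrite normrN.
  have d1 := ift_m_lip I (dom _ s01) (dom _ t01).
  have d2 := ift_D_lip I (dp t) (dom _ s01) (dom _ t01).
  have := dpC _ t01; rewrite -/a => dpa.
  have q : `|s - t| + `|p s - p t| <= (1 + L) * `|s - t|.
    by rewrite mulrDl mul1r lerD2l pL.
  have q' : C * (`|s - t| + `|p s - p t|) <= C * ((1 + L) * `|s - t|) by rewrite ler_pM2l.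
  apply: le_trans (lerD d1 d2) _.
  apply: le_trans (_ : C * ((1 + L) * `|s - t|) * (1 + a) <= _); last first.
    by rewrite le_eqVlt; apply/orP; left; apply/eqP; ring.
  rewrite [leRHS]mulrDr mulr1; apply: lerD => //; apply: ler_pM => //.
  by rewrite mulr_ge0 ?addr_ge0 // ltW.
Qed.

(** * Correcting the straight motion to a grid *)

(** Taylor and Lipschitz bounds uniform in [chi]. The class is stable under sums and products, so
    the bounds for [phi] are assembled from those of the coordinates and of the coefficients in
    [chi]. *)
Definition smooth_on_box {R : realType} (r : R) (f fx fy : R -> R -> R -> R) :=
  exists2 C : R, 0 < C & forall chi x y x' y', 0 <= chi <= 1 ->
    `|x| <= r -> `|y| <= r -> `|x'| <= r -> `|y'| <= r ->
    let d := `|x' - x| + `|y' - y| in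
    [/\ [/\ `|f chi x y| <= C, `|fx chi x y| <= C & `|fy chi x y| <= C],
        `|fx chi x' y' - fx chi x y| <= C * d,
        `|fy chi x' y' - fy chi x y| <= C * d &
        `|f chi x' y' - f chi x y - fx chi x y * (x' - x)
           - fy chi x y * (y' - y)| <= C * d ^+ 2].

Lemma smooth_param (R : realType) (r : R) (c : R -> R) (b : R) :
  (forall chi, 0 <= chi <= 1 -> `|c chi| <= b) ->
  smooth_on_box r (fun chi _ _ => c chi) (fun _ _ _ => 0) (fun _ _ _ => 0).
Proof.
move=> cb; exists (1 + `|b|); first by rewrite ltr_pwDl.
move=> chi x y x' y' chi01 _ _ _ _ d.
have b0 : 0 <= 1 + `|b| by rewrite addr_ge0.
have d0 : 0 <= d by rewrite addr_ge0.
rewrite !subrr !mul0r !subr0 normr0; split => //; last 3 first.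
- by rewrite mulr_ge0.
- by rewrite mulr_ge0.
- by rewrite mulr_ge0 ?exprn_ge0.
split => //; apply: le_trans (cb _ chi01) _.
by rewrite (le_trans (ler_norm _)) // lerDr.
Qed.

Lemma smooth_fst (R : realType) (r : R) : 0 < r ->
  smooth_on_box r (fun _ x _ => x) (fun _ _ _ => 1) (fun _ _ _ => 0).
Proof.
move=> r0; exists (1 + r); first by rewrite addr_gt0.
move=> chi x y x' y' _ xr _ _ _ d.
have b0 : 0 <= 1 + r by rewrite addr_ge0 // ltW.
have d0 : 0 <= d by rewrite addr_ge0.
rewrite !subrr mul1r mul0r subr0 subrr normr0 normr1; split.
- by split => //; lra.
- by rewrite mulr_ge0.
- by rewrite mulr_ge0.
- by rewrite mulr_ge0 ?exprn_ge0.
Qed.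

Lemma smooth_snd (R : realType) (r : R) : 0 < r ->
  smooth_on_box r (fun _ _ y => y) (fun _ _ _ => 0) (fun _ _ _ => 1).
Proof.
move=> r0; exists (1 + r); first by rewrite addr_gt0.
move=> chi x y x' y' _ _ yr _ _ d.
have b0 : 0 <= 1 + r by rewrite addr_ge0 // ltW.
have d0 : 0 <= d by rewrite addr_ge0.
rewrite !subrr mul1r mul0r subr0 subrr normr0 normr1; split.
- by split => //; lra.
- by rewrite mulr_ge0.
- by rewrite mulr_ge0.
- by rewrite mulr_ge0 ?exprn_ge0.
Qed.

Lemma smooth_add (R : realType) (r : R) (f fx fy g gx gy : R -> R -> R -> R) :
  smooth_on_box r f fx fy -> smooth_on_box r g gx gy ->
  smooth_on_box r (fun c x y => f c x y + g c x y)
    (fun c x y => fx c x y + gx c x y) (fun c x y => fy c x y + gy c x y).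
Proof.
move=> [C C0 hf] [C' C'0 hg]; exists (C + C'); first by rewrite addr_gt0.
move=> c x y x' y' c01 xr yr x'r y'r d.
have [[f1 f2 f3] f4 f5 f6] := hf c x y x' y' c01 xr yr x'r y'r.
have [[g1 g2 g3] g4 g5 g6] := hg c x y x' y' c01 xr yr x'r y'r.
rewrite -/d in f4 f5 f6 g4 g5 g6.
split; [split|..].
- by rewrite (le_trans (ler_normD _ _)) // lerD.
- by rewrite (le_trans (ler_normD _ _)) // lerD.
- by rewrite (le_trans (ler_normD _ _)) // lerD.
- rewrite [leRHS]mulrDl; apply: (le_trans _ (lerD f4 g4)).
  apply: (le_trans _ (ler_normD _ _)); rewrite le_eqVlt; apply/orP; left.
  by apply/eqP; congr (`|_|); ring.
- rewrite [leRHS]mulrDl; apply: (le_trans _ (lerD f5 g5)).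
  apply: (le_trans _ (ler_normD _ _)); rewrite le_eqVlt; apply/orP; left.
  by apply/eqP; congr (`|_|); ring.
- rewrite [leRHS]mulrDl; apply: (le_trans _ (lerD f6 g6)).
  apply: (le_trans _ (ler_normD _ _)); rewrite le_eqVlt; apply/orP; left.
  by apply/eqP; congr (`|_|); ring.
Qed.

Lemma smooth_mul (R : realType) (r : R) (f fx fy g gx gy : R -> R -> R -> R) :
  0 < r ->
  smooth_on_box r f fx fy -> smooth_on_box r g gx gy ->
  smooth_on_box r (fun c x y => f c x y * g c x y)
    (fun c x y => fx c x y * g c x y + f c x y * gx c x y)
    (fun c x y => fy c x y * g c x y + f c x y * gy c x y).
Proof.
move=> r0 [C C0 hf] [C' C'0 hg].
(* On the box [d <= 4 r], so the Taylor bounds make [f] and [g] Lipschitz with constants [C L] and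
   [C' L]. In the final constant, [2] covers the product rule and the two Taylor remainders, [4 L]
   the variation of the gradient and [L ^+ 2] the product of the two increments. *)
pose L := 1 + 4 * r.
have L0 : 0 < L by rewrite addr_gt0 // mulr_gt0.
exists (C * C' * (2 + 4 * L + L ^+ 2)).
  by rewrite !mulr_gt0 // !addr_gt0 ?mulr_gt0 // exprn_gt0.
move=> c x y x' y' c01 xr yr x'r y'r d.
have [[f1 f2 f3] f4 f5 f6] := hf c x y x' y' c01 xr yr x'r y'r.
have [[g1 g2 g3] g4 g5 g6] := hg c x y x' y' c01 xr yr x'r y'r.
have [[f1' f2' f3'] _ _ _] := hf c x' y' x' y' c01 x'r y'r x'r y'r.
have [[g1' g2' g3'] _ _ _] := hg c x' y' x' y' c01 x'r y'r x'r y'r.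
rewrite -/d in f4 f5 f6 g4 g5 g6.
have d0 : 0 <= d by rewrite addr_ge0.
have d4 : d <= 4 * r.
  by move: (ler_normB x' x) (ler_normB y' y) xr yr x'r y'r; rewrite /d; clear; lra.
have lip (a a' ax ay A : R) : 0 < A -> `|ax| <= A -> `|ay| <= A ->
    `|a' - a - ax * (x' - x) - ay * (y' - y)| <= A * d ^+ 2 ->
    `|a' - a| <= A * L * d.
  move=> A0 hx hy h.
  have -> : a' - a = (a' - a - ax * (x' - x) - ay * (y' - y)) +
    (ax * (x' - x) + ay * (y' - y)) by ring.
  apply: le_trans (ler_normD _ _) _.
  have : `|ax * (x' - x) + ay * (y' - y)| <= A * d.
    rewrite /d [leRHS]mulrDr; apply: le_trans (ler_normD _ _) _.
    by rewrite !normrM lerD // ler_wpM2r.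
  have : A * d ^+ 2 <= A * (4 * r * d) by rewrite ler_pM2l // expr2 ler_wpM2r.
  move: h; rewrite /L; clear; lra.
have fL := lip _ _ _ _ _ C0 f2 f3 f6.
have gL := lip _ _ _ _ _ C'0 g2 g3 g6.
have CC : 0 < C * C' by rewrite mulr_gt0.
have b1 (a b : R) : `|a| <= C -> `|b| <= C' -> `|a * b| <= C * C'.
  by move=> ha hb; rewrite normrM ler_pM.
have CCL : C * C' <= C * C' * (2 + 4 * L + L ^+ 2).
  by rewrite ler_pMr //; move: L0; clear; nra.
have CC2 : 2 * (C * C') <= C * C' * (2 + 4 * L + L ^+ 2).
  by rewrite mulrC ler_pM2l //; move: L0; clear; nra.
have grad (a a' b b' : R) : `|a| <= C -> `|b'| <= C' -> `|b| <= C' -> `|a' - a| <= C * L * d ->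
   `|b' - b| <= C' * L * d -> `|a' * b' - a * b| <= 2 * L * (C * C') * d.
  move=> ha hb' hb haa hbb.
  have -> : a' * b' - a * b = (a' - a) * b' + a * (b' - b) by ring.
  apply: le_trans (ler_normD _ _) _; rewrite !normrM.
  have : `|a' - a| * `|b'| <= C * L * d * C' by rewrite ler_pM.
  have : `|a| * `|b' - b| <= C * (C' * L * d) by rewrite ler_pM.
  clear; lra.
have wk (A v : R) : 0 < A -> `|v| <= A * d -> `|v| <= A * L * d.
  move=> A0 h; apply: le_trans h _; rewrite mulrAC ler_peMr // ?mulr_ge0 //; first exact: ltW.
  by rewrite /L lerDl mulr_ge0 // ltW.
have grad2 (u u' v v' : R) : `|u| <= C -> `|v| <= C' -> `|u' - u| <= C * d ->
    `|v' - v| <= C' * d -> `|v'| <= C' ->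
    `|u' * g c x' y' + f c x' y' * v' - (u * g c x y + f c x y * v)| <=
       C * C' * (2 + 4 * L + L ^+ 2) * d.
  move=> hu hv hu' hv' hv2.
  have -> : u' * g c x' y' + f c x' y' * v' - (u * g c x y + f c x y * v) =
    (u' * g c x' y' - u * g c x y) + (f c x' y' * v' - f c x y * v) by ring.
  have e1 := grad _ _ _ _ hu g1' g1 (wk _ _ C0 hu') gL.
  have e2 := grad _ _ _ _ f1 hv2 hv fL (wk _ _ C'0 hv').
  apply: le_trans (ler_normD _ _) _; apply: le_trans (lerD e1 e2) _.
  have -> : 2 * L * (C * C') * d + 2 * L * (C * C') * d = C * C' * (4 * L) * d by ring.
  rewrite ler_wpM2r // ler_pM2l //.
  by move: (sqr_ge0 L); clear; lra.
split; [split|..].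
- by apply: le_trans (b1 _ _ f1 g1) CCL.
- apply: (le_trans _ CC2); apply: le_trans (ler_normD _ _) _.
  by move: (b1 _ _ f2 g1) (b1 _ _ f1 g2); clear; lra.
- apply: (le_trans _ CC2); apply: le_trans (ler_normD _ _) _.
  by move: (b1 _ _ f3 g1) (b1 _ _ f1 g3); clear; lra.
- exact: grad2.
- exact: grad2.
- have -> : f c x' y' * g c x' y' - f c x y * g c x y -
    (fx c x y * g c x y + f c x y * gx c x y) * (x' - x) -
    (fy c x y * g c x y + f c x y * gy c x y) * (y' - y) =
    (f c x' y' - f c x y - fx c x y * (x' - x) - fy c x y * (y' - y)) * g c x y
    + f c x y * (g c x' y' - g c x y - gx c x y * (x' - x) - gy c x y * (y' - y))
    + (f c x' y' - f c x y) * (g c x' y' - g c x y) by ring.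
  have e1 : `|(f c x' y' - f c x y - fx c x y * (x' - x) - fy c x y * (y' - y)) * g c x y|
      <= C * d ^+ 2 * C' by rewrite normrM ler_pM.
  have e2 : `|f c x y * (g c x' y' - g c x y - gx c x y * (x' - x) - gy c x y * (y' - y))|
      <= C * (C' * d ^+ 2) by rewrite normrM ler_pM.
  have e3 : `|(f c x' y' - f c x y) * (g c x' y' - g c x y)| <= (C * L * d) * (C' * L * d).
    by rewrite normrM ler_pM.
  apply: le_trans (ler_normD _ _) _.
  apply: le_trans (lerD (le_trans (ler_normD _ _) (lerD e1 e2)) e3) _.
  have : 0 <= C * C' * (4 * L) * d ^+ 2 by rewrite !mulr_ge0 ?exprn_ge0 // ltW // mulr_gt0.
  clear; lra.
Qed.

Lemma smooth_ext (R : realType) (r : R) (f fx fy f' fx' fy' : R -> R -> R -> R) :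
  smooth_on_box r f fx fy ->
  (forall c x y, [/\ f' c x y = f c x y, fx' c x y = fx c x y & fy' c x y = fy c x y]) ->
  smooth_on_box r f' fx' fy'.
Proof.
move=> [C C0 h] e; exists C => // c x y x' y' c01 xr yr x'r y'r d.
have [-> -> ->] := e c x y; have [-> -> ->] := e c x' y'.
exact: h.
Qed.

Lemma smooth_phi (R : realType) (r : R) (i : 'I_4) : 0 < r ->
  smooth_on_box r (fun chi x y => phi chi x y i) (fun chi x y => phix chi x y i)
    (fun chi x y => phiy chi x y i).
Proof.
move=> r0; have sx := smooth_fst r0; have sy := smooth_snd r0.
have sr := smooth_add (smooth_mul r0 sx sx) (smooth_mul r0 sy sy).
have sm : smooth_on_box r (fun chi _ _ => 1 - chi) (fun _ _ _ => 0) (fun _ _ _ => 0).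
  by apply: (@smooth_param R r (fun chi => 1 - chi) 2) => chi chi01; rewrite ler_norml; lra.
have sp : smooth_on_box r (fun chi _ _ => - (1 + chi)) (fun _ _ _ => 0) (fun _ _ _ => 0).
  by apply: (@smooth_param R r (fun chi => - (1 + chi)) 2) => chi chi01; rewrite ler_norml; lra.
have sq := smooth_add (smooth_mul r0 sm (smooth_mul r0 sx sx))
   (smooth_mul r0 sp (smooth_mul r0 sy sy)).
case: i => -[|[|[|[|//]]]] i4; rewrite /phi /phix /phiy /=.
- by apply: (smooth_ext (smooth_mul r0 sr sx)) => c x y; split; ring.
- by apply: (smooth_ext (smooth_mul r0 sr sy)) => c x y; split; ring.
- by apply: (smooth_ext (smooth_mul r0 sr (smooth_mul r0 sx sy))) => c x y; split; ring.
- by apply: (smooth_ext (smooth_mul r0 sr sq)) => c x y; split; ring.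
Qed.

Definition phi_bound {R : realType} (r C : R) := forall (i : 'I_4) (chi x y x' y' : R),
    0 <= chi <= 1 ->
    `|x| <= r -> `|y| <= r -> `|x'| <= r -> `|y'| <= r ->
    let d := `|x' - x| + `|y' - y| in
    [/\ `|phix chi x y i| <= C /\ `|phiy chi x y i| <= C,
        `|phix chi x' y' i - phix chi x y i| <= C * d,
        `|phiy chi x' y' i - phiy chi x y i| <= C * d &
        `|phi chi x' y' i - phi chi x y i - phix chi x y i * (x' - x)
           - phiy chi x y i * (y' - y)| <= C * d ^+ 2].

Lemma phi_smooth (R : realType) (r : R) : 0 < r ->
  exists2 C : R, 0 < C & phi_bound r C.
Proof.
move=> r0.
(* The property of [C] is inferred from [smooth_phi]; the [let] only repackages [exists2] in the
   form expected by [choice]. *)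
have /choice[C hC] (i : 'I_4) : exists C : R, 0 < C /\ _ :=
  let: ex_intro2 C C0 h := smooth_phi i r0 in ex_intro _ C (conj C0 h).
have le i : C i <= \sum_i C i.
  by rewrite (bigD1 i) //= lerDl sumr_ge0 // => j _; rewrite ltW // (hC j).1.
exists (\sum_i C i).
  by apply: (lt_le_trans _ (le 0)); rewrite (hC 0).1.
move=> i chi x y x' y' c01 xr yr x'r y'r d.
have d0 : 0 <= d by rewrite addr_ge0.
have [[_ f2 f3] f4 f5 f6] := (hC i).2 chi x y x' y' c01 xr yr x'r y'r.
split; first by split; apply: (le_trans _ (le i)).
- by apply: le_trans f4 _; rewrite ler_wpM2r.
- by apply: le_trans f5 _; rewrite ler_wpM2r.
- by apply: le_trans f6 _; rewrite ler_wpM2r ?exprn_ge0.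
Qed.

Lemma rV_norm_le (R : realType) (n : nat) (v : 'rV[R]_n) (c : R) :
  0 <= c -> (forall i, `|v 0 i| <= c) -> `|v| <= c.
Proof.
move=> c0 h; rewrite /Num.norm /= mx_normrE; apply: bigmax_le => // -[i j] _ /=.
by rewrite ord1.
Qed.

Lemma rV_coord_norm_le (R : realType) (n : nat) (v : 'rV[R]_n) i : `|v 0 i| <= `|v|.
Proof.
rewrite [leRHS]/Num.norm /= mx_normrE.
exact: (@le_bigmax _ _ _ _ (fun ij => `|v ij.1 ij.2|) (0, i)).
Qed.

Lemma norm_mean_le (R : realType) (N : nat) (F : 'I_N -> R) (c : R) : (0 < N)%N ->
  (forall k, `|F k| <= c) -> `|N%:R^-1 * \sum_k F k| <= c.
Proof.
move=> N0 h; have n0 : 0 < N%:R :> R by rewrite ltr0n.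
rewrite normrM ger0_norm ?invr_ge0 ?ler0n // mulrC ler_pdivrMr //.
apply: le_trans (ler_norm_sum _ _ _) _; apply: le_trans (ler_sum _ (fun k _ => h k)) _.
by rewrite sumr_const card_ord mulr_natr.
Qed.

Lemma norm_sum4_le (R : realType) (F : 'I_4 -> R) (c : R) :
  (forall k, `|F k| <= c) -> `|\sum_k F k| <= 4 * c.
Proof.
move=> h; apply: le_trans (ler_norm_sum _ _ _) _.
apply: le_trans (ler_sum _ (fun k _ => h k)) _.
by rewrite sumr_const card_ord mulr_natl.
Qed.

(* The straight motion from [(x, y)] to [(gx, gy)], corrected along the
   gradients of the constraints at the endpoint [(gx, gy)]: the position at
   time 1 only depends on [(gx, gy)]. *)
Definition zetax {R : realType} (chi x gx gy t : R) (p : 'rV[R]_4) :=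
  x + t * (gx - x) + \sum_j p 0 j * phix chi gx gy j.
Definition zetay {R : realType} (chi y gx gy t : R) (p : 'rV[R]_4) :=
  y + t * (gy - y) + \sum_j p 0 j * phiy chi gx gy j.

(** The summands are, in order, the constants obtained for [ift_taylor], [ift_D_bounded],
    [ift_D_lip], [ift_m_bounded] and [ift_m_lip]; their sum serves for all five. *)
Definition ift_const {R : realType} (C : R) : R :=
  4 * C * (1 + 4 * C) ^+ 2 + 8 * C ^+ 2 + 16 * C ^+ 2 * (1 + 4 * C)
    + 2 * C + 4 * C * (1 + 4 * C).

Lemma ift_const_ge (R : realType) (C : R) : 0 < C ->
  0 <= ift_const C /\
  [/\ 4 * C * (1 + 4 * C) ^+ 2 <= ift_const C, 8 * C ^+ 2 <= ift_const C,
      16 * C ^+ 2 * (1 + 4 * C) <= ift_const C, 2 * C <= ift_const C &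
      4 * C * (1 + 4 * C) <= ift_const C].
Proof.
move=> C0; have C20 : 0 < C ^+ 2 by rewrite exprn_gt0.
have C30 : 0 < C ^+ 3 by rewrite exprn_gt0.
by rewrite /ift_const; split; [lra|split; lra].
Qed.

Definition motion_H {R : realType} (chi : R) (N : nat) (x y gx gy : 'I_N -> R)
    (t : R) (p : 'rV[R]_4) : 'rV[R]_4 :=
  \row_i (N%:R^-1 * \sum_k phi chi (zetax chi (x k) (gx k) (gy k) t p)
                                   (zetay chi (y k) (gx k) (gy k) t p) i).
Definition motion_m {R : realType} (chi : R) (N : nat) (x y gx gy : 'I_N -> R)
    (t : R) (p : 'rV[R]_4) : 'rV[R]_4 :=
  \row_i (N%:R^-1 * \sum_k
    (phix chi (zetax chi (x k) (gx k) (gy k) t p)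
              (zetay chi (y k) (gx k) (gy k) t p) i * (gx k - x k) +
     phiy chi (zetax chi (x k) (gx k) (gy k) t p)
              (zetay chi (y k) (gx k) (gy k) t p) i * (gy k - y k))).
(** The derivative of [motion_H] in [p]. If the moving points and the grid points coincide with the
    initial points, this is [N%:R^-1] times the Gram matrix bounded below by [phi_gram_coercive]. *)
Definition motion_D {R : realType} (chi : R) (N : nat) (x y gx gy : 'I_N -> R)
    (t : R) (p : 'rV[R]_4) : 'M[R]_4 :=
  \matrix_(j, i) (N%:R^-1 * \sum_k
    (phix chi (zetax chi (x k) (gx k) (gy k) t p)
              (zetay chi (y k) (gx k) (gy k) t p) i * phix chi (gx k) (gy k) j +
     phiy chi (zetax chi (x k) (gx k) (gy k) t p)
              (zetay chi (y k) (gx k) (gy k) t p) i * phiy chi (gx k) (gy k) j)).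

Lemma motion_DE (R : realType) (chi : R) (N : nat) (x y gx gy : 'I_N -> R) t p
    (q : 'rV[R]_4) i :
  (q *m motion_D chi x y gx gy t p) 0 i = N%:R^-1 * \sum_k
    (phix chi (zetax chi (x k) (gx k) (gy k) t p)
              (zetay chi (y k) (gx k) (gy k) t p) i *
        (\sum_j q 0 j * phix chi (gx k) (gy k) j) +
     phiy chi (zetax chi (x k) (gx k) (gy k) t p)
              (zetay chi (y k) (gx k) (gy k) t p) i *
        (\sum_j q 0 j * phiy chi (gx k) (gy k) j)).
Proof.
rewrite mxE; under eq_bigr do rewrite mxE mulrCA mulr_sumr.
rewrite -mulr_sumr exchange_big /=; congr (_ * _); apply: eq_bigr => k _.
rewrite !mulr_sumr -big_split; apply: eq_bigr => j _ /=; ring.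
Qed.

Lemma rV_sub4E (R : realType) (n : nat) (a b c d : 'rV[R]_n) i :
  (a - b - c - d) 0 i = a 0 i - b 0 i - c 0 i - d 0 i.
Proof. by rewrite !mxE. Qed.

Lemma rV_sub2E (R : realType) (n : nat) (a b : 'rV[R]_n) i :
  (a - b) 0 i = a 0 i - b 0 i.
Proof. by rewrite !mxE. Qed.

Lemma norm_lin4_le (R : realType) (v : 'rV[R]_4) (F : 'I_4 -> R) (c : R) :
  (forall i, `|F i| <= c) -> `|\sum_j v 0 j * F j| <= 4 * c * `|v|.
Proof.
move=> hF; rewrite -mulrA; apply: norm_sum4_le => j.
by rewrite normrM mulrC ler_pM // rV_coord_norm_le.
Qed.

Lemma zetax_close (R : realType) (chi x gx gy eps C del t : R) (p : 'rV[R]_4) :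
  0 <= C -> `|gx - x| <= eps -> (forall j, `|phix chi gx gy j| <= C) ->
  ift_dom del t p -> `|zetax chi x gx gy t p - x| <= eps + 4 * C * del.
Proof.
move=> C0 ge hC /andP[/andP[t0 t1] pd].
rewrite /zetax; have e (a b c : R) : a + b + c - a = b + c by ring.
rewrite e; apply: le_trans (ler_normD _ _) _; apply: lerD.
  by rewrite normrM (ger0_norm t0); apply: (le_trans _ ge); rewrite ler_piMl.
by apply: le_trans (norm_lin4_le _ hC) _; rewrite ler_wpM2l // mulr_ge0.
Qed.

Lemma zetay_close (R : realType) (chi y gx gy eps C del t : R) (p : 'rV[R]_4) :
  0 <= C -> `|gy - y| <= eps -> (forall j, `|phiy chi gx gy j| <= C) ->
  ift_dom del t p -> `|zetay chi y gx gy t p - y| <= eps + 4 * C * del.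
Proof.
move=> C0 ge hC /andP[/andP[t0 t1] pd].
rewrite /zetay; have e (a b c : R) : a + b + c - a = b + c by ring.
rewrite e; apply: le_trans (ler_normD _ _) _; apply: lerD.
  by rewrite normrM (ger0_norm t0); apply: (le_trans _ ge); rewrite ler_piMl.
by apply: le_trans (norm_lin4_le _ hC) _; rewrite ler_wpM2l // mulr_ge0.
Qed.

(** Of the last three conditions, the first keeps the moving points in the box of radius [2 K], the
    second keeps [motion_D] close to the Gram matrix at the initial points, and the third gives
    [ift_small]. In [eta0 / 8], a factor 2 is lost to this perturbation and a factor 4 to the sup
    norm in dimension 4. *)
Lemma phi_ift_data (R : realType) (K C eta0 chi eps del : R) (N : nat)
    (x y gx gy : 'I_N -> R) :
  1 < K -> 0 < C -> phi_bound (2 * K) C -> 0 < eta0 -> 0 <= chi <= 1 -> (0 < N)%N ->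
  (forall k, `|x k| <= K) -> (forall k, `|y k| <= K) ->
  (forall i, \sum_k phi chi (x k) (y k) i = 0) ->
  (forall q : 'rV[R]_4, eta0 * `|q| ^+ 2 * N%:R <=
      \sum_k ((\sum_i q 0 i * phix chi (x k) (y k) i) ^+ 2 +
              (\sum_i q 0 i * phiy chi (x k) (y k) i) ^+ 2)) ->
  (forall k, `|gx k - x k| <= eps) -> (forall k, `|gy k - y k| <= eps) ->
  0 < eps -> 0 < del ->
  eps + 4 * C * del <= (4 * K)^-1 ->
  256 * C ^+ 2 * (eps + 4 * C * del) <= eta0 ->
  4 * C * eps < eta0 / 8 * del / 4 ->
  ift_data (eta0 / 8) (ift_const C) del (motion_H chi x y gx gy)
    (motion_m chi x y gx gy) (motion_D chi x y gx gy).
Proof.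
move=> K1 C0 hC eta00 chi01 N0 xK yK mom coer gxe gye eps0 del0 c1 c2 c3.
have K0 : 0 < K by lra.
have K4 : (4 * K)^-1 <= 4^-1 by rewrite lef_pV2 ?posrE ?mulr_gt0 //; lra.
pose rho := eps + 4 * C * del.
have rho0 : 0 < rho by rewrite addr_gt0 // !mulr_gt0.
have rho1 : rho <= 4^-1 by exact: le_trans c1 K4.
have epsrho : eps <= rho by rewrite lerDl !mulr_ge0 // ltW.
have gxK k : `|gx k| <= 2 * K.
  by rewrite -[gx k](subrK (x k)); apply: le_trans (ler_normD _ _) _;
    move: (gxe k) (xK k) epsrho rho1 K1; clear; lra.
have gyK k : `|gy k| <= 2 * K.
  by rewrite -[gy k](subrK (y k)); apply: le_trans (ler_normD _ _) _;
    move: (gye k) (yK k) epsrho rho1 K1; clear; lra.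
have x2K k : `|x k| <= 2 * K by have := xK k; lra.
have y2K k : `|y k| <= 2 * K by have := yK k; lra.
have bd i a b : `|a| <= 2 * K -> `|b| <= 2 * K ->
    `|phix chi a b i| <= C /\ `|phiy chi a b i| <= C.
  by move=> ha hb; have [] := hC i chi a b a b chi01 ha hb ha hb.
have Vx k (v : 'rV[R]_4) : `|\sum_j v 0 j * phix chi (gx k) (gy k) j| <= 4 * C * `|v|.
  by apply: norm_lin4_le => j; have [] := bd j _ _ (gxK k) (gyK k).
have Vy k (v : 'rV[R]_4) : `|\sum_j v 0 j * phiy chi (gx k) (gy k) j| <= 4 * C * `|v|.
  by apply: norm_lin4_le => j; have [] := bd j _ _ (gxK k) (gyK k).
have zxr t p k : ift_dom del t p -> `|zetax chi (x k) (gx k) (gy k) t p - x k| <= rho.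
  by apply: (zetax_close (ltW C0)) => // j; have [] := bd j _ _ (gxK k) (gyK k).
have zyr t p k : ift_dom del t p -> `|zetay chi (y k) (gx k) (gy k) t p - y k| <= rho.
  by apply: (zetay_close (ltW C0)) => // j; have [] := bd j _ _ (gxK k) (gyK k).
have zxK t p k : ift_dom del t p -> `|zetax chi (x k) (gx k) (gy k) t p| <= 2 * K.
  move=> d; rewrite -[zetax _ _ _ _ _ _](subrK (x k)); apply: le_trans (ler_normD _ _) _.
  by move: (zxr _ _ k d) (xK k) rho1 K1; clear; lra.
have zyK t p k : ift_dom del t p -> `|zetay chi (y k) (gx k) (gy k) t p| <= 2 * K.
  move=> d; rewrite -[zetay _ _ _ _ _ _](subrK (y k)); apply: le_trans (ler_normD _ _) _.
  by move: (zyr _ _ k d) (yK k) rho1 K1; clear; lra.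
have dzx s t p p' k : zetax chi (x k) (gx k) (gy k) s p' - zetax chi (x k) (gx k) (gy k) t p =
   (s - t) * (gx k - x k) + \sum_j (p' - p) 0 j * phix chi (gx k) (gy k) j.
  rewrite /zetax; under [X in _ = _ + X]eq_bigr do rewrite !mxE mulrBl.
  by rewrite sumrB; ring.
have dzy s t p p' k : zetay chi (y k) (gx k) (gy k) s p' - zetay chi (y k) (gx k) (gy k) t p =
   (s - t) * (gy k - y k) + \sum_j (p' - p) 0 j * phiy chi (gx k) (gy k) j.
  rewrite /zetay; under [X in _ = _ + X]eq_bigr do rewrite !mxE mulrBl.
  by rewrite sumrB; ring.
have zd s t p p' k :
    `|zetax chi (x k) (gx k) (gy k) s p' - zetax chi (x k) (gx k) (gy k) t p| +
    `|zetay chi (y k) (gx k) (gy k) s p' - zetay chi (y k) (gx k) (gy k) t p| <=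
    2 * (1 + 4 * C) * (`|s - t| + `|p' - p|).
  have one (v w : R) : `|v| <= eps -> `|w| <= 4 * C * `|p' - p| ->
      `|(s - t) * v + w| <= (1 + 4 * C) * (`|s - t| + `|p' - p|).
    move=> hv hw; apply: le_trans (ler_normD _ _) _; rewrite normrM.
    have : `|s - t| * `|v| <= `|s - t| * 1 by rewrite ler_wpM2l //; lra.
    have : 0 <= 4 * C * `|s - t| by rewrite !mulr_ge0 // ltW.
    by have := normr_ge0 (p' - p); lra.
  rewrite dzx dzy.
  have := one _ _ (gxe k) (Vx k (p' - p)); have := one _ _ (gye k) (Vy k (p' - p)).
  lra.
have [k0 [k1 k2 k3 k4 k5]] := ift_const_ge C0.
have u0 (s t : R) (p p' : 'rV[R]_4) : 0 <= `|s - t| + `|p' - p| by rewrite addr_ge0.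
have gx1 k : `|gx k - x k| <= 1 by move: (gxe k) epsrho rho1; clear; lra.
have gy1 k : `|gy k - y k| <= 1 by move: (gye k) epsrho rho1; clear; lra.
split.
- move=> s t p p' ds dt; apply: rV_norm_le; first by rewrite mulr_ge0 // exprn_ge0.
  move=> i; rewrite rV_sub4E motion_DE !mxE mulrCA -!mulrBr mulr_sumr -!sumrB.
  apply: norm_mean_le => // k.
  have [_ _ _] := hC i chi _ _ _ _ chi01 (zxK t p k dt) (zyK t p k dt)
     (zxK s p' k ds) (zyK s p' k ds).
  have := zd s t p p' k; rewrite dzx dzy => hd T.
  set e := (X in `|X|); set f := (X in `|X| <= _) in T.
  have -> : e = f by rewrite /e /f; ring.
  apply: le_trans T _.
  apply: le_trans (_ : C * (2 * (1 + 4 * C) * (`|s - t| + `|p' - p|)) ^+ 2 <= _).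
    by rewrite ler_pM2l // lerXn2r // nnegrE ?addr_ge0 // mulr_ge0 // ltW //
      mulr_gt0 // addr_gt0 // mulr_gt0.
  rewrite exprMn mulrA ler_wpM2r ?exprn_ge0 //; apply: le_trans k1.
  by rewrite le_eqVlt; apply/orP; left; apply/eqP; ring.
- move=> t p q d; have [->|q0] := eqVneq q 0; first by rewrite mul0mx normr0 mulr0.
  have nq : 0 < `|q| by rewrite normr_gt0.
  (* [G] is the pairing with [q]: a lower bound on the quadratic form of [motion_D] at [q] bounds
     [|q *m D|] from below. *)
  pose G (F : 'I_4 -> R) := \sum_j q 0 j * F j.
  have qDE : G ((q *m motion_D chi x y gx gy t p) 0) = N%:R^-1 * \sum_k
    (G (phix chi (zetax chi (x k) (gx k) (gy k) t p) (zetay chi (y k) (gx k) (gy k) t p))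
      * G (phix chi (gx k) (gy k)) +
     G (phiy chi (zetax chi (x k) (gx k) (gy k) t p) (zetay chi (y k) (gx k) (gy k) t p))
      * G (phiy chi (gx k) (gy k))).
    rewrite /G; under eq_bigr do rewrite motion_DE mulrCA mulr_sumr.
    rewrite -mulr_sumr exchange_big /=; congr (_ * _); apply: eq_bigr => k _.
    by rewrite !mulr_suml -big_split; apply: eq_bigr => j _ /=; ring.
  have up : G ((q *m motion_D chi x y gx gy t p) 0) <=
      4 * `|q *m motion_D chi x y gx gy t p| * `|q|.
    apply: le_trans (ler_norm _) _; apply: norm_lin4_le => j; exact: rV_coord_norm_le.
  have lo : eta0 / 2 * `|q| ^+ 2 <= G ((q *m motion_D chi x y gx gy t p) 0).
    have n0 : 0 < N%:R :> R by rewrite ltr0n.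
    rewrite qDE [leRHS]mulrC ler_pdivlMr //.
    have h : eta0 * `|q| ^+ 2 * N%:R - \sum_(k < N) (eta0 / 2 * `|q| ^+ 2) =
       eta0 / 2 * `|q| ^+ 2 * N%:R by rewrite sumr_const card_ord -[_ *+ N]mulr_natr; field.
    rewrite -h; apply: le_trans (lerB (coer q) (lexx _)) _.
    rewrite -sumrB; apply: ler_sum => k _.
    have Gd (F F' : 'I_4 -> R) : (forall j, `|F' j - F j| <= C * (2 * rho)) ->
        `|G F' - G F| <= 8 * C * rho * `|q|.
      move=> hF; rewrite /G -sumrB; under eq_bigr do rewrite -mulrBr.
      apply: le_trans (norm_lin4_le _ hF) _.
      by rewrite le_eqVlt; apply/orP; left; apply/eqP; ring.
    have hz j := hC j chi _ _ _ _ chi01 (x2K k) (y2K k) (zxK t p k d) (zyK t p k d).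
    have hg j := hC j chi _ _ _ _ chi01 (x2K k) (y2K k) (gxK k) (gyK k).
    have dz : `|zetax chi (x k) (gx k) (gy k) t p - x k| +
              `|zetay chi (y k) (gx k) (gy k) t p - y k| <= 2 * rho.
      by move: (zxr t p k d) (zyr t p k d); clear; lra.
    have dg : `|gx k - x k| + `|gy k - y k| <= 2 * rho.
      by move: (gxe k) (gye k) epsrho; clear; lra.
    (* Both factors are within [8 C rho |q|] of the value [A0] at the initial point, so their
       product differs from [A0 ^+ 2] by at most [64 C^2 rho |q|^2]; this is the source of the
       constant 256. *)
    have prd (A0 A a : R) : `|A0| <= 4 * C * `|q| -> `|a| <= 4 * C * `|q| ->
        `|A - A0| <= 8 * C * rho * `|q| -> `|a - A0| <= 8 * C * rho * `|q| ->
        A0 ^+ 2 - eta0 / 4 * `|q| ^+ 2 <= A * a.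
      move=> hA0 ha hA haA.
      have e : A0 ^+ 2 - A * a = - ((A - A0) * a + A0 * (a - A0)) by ring.
      have : `|A0 ^+ 2 - A * a| <=
          8 * C * rho * `|q| * (4 * C * `|q|) + 4 * C * `|q| * (8 * C * rho * `|q|).
        rewrite e normrN; apply: le_trans (ler_normD _ _) _; rewrite !normrM.
        by apply: lerD; apply: ler_pM.
      have := ler_norm (A0 ^+ 2 - A * a).
      have := ler_wpM2r (exprn_ge0 2 (ltW nq)) c2; rewrite -/rho.
      clear; lra.
    have px : (G (phix chi (x k) (y k))) ^+ 2 - eta0 / 4 * `|q| ^+ 2 <=
       G (phix chi (zetax chi (x k) (gx k) (gy k) t p) (zetay chi (y k) (gx k) (gy k) t p))
      * G (phix chi (gx k) (gy k)).
      apply: prd.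
      - by apply: norm_lin4_le => j; have [] := bd j _ _ (x2K k) (y2K k).
      - by apply: norm_lin4_le => j; have [] := bd j _ _ (gxK k) (gyK k).
      - apply: Gd => j; have [_ h1 _ _] := hz j; apply: le_trans h1 _.
        by rewrite ler_pM2l.
      - apply: Gd => j; have [_ h1 _ _] := hg j; apply: le_trans h1 _.
        by rewrite ler_pM2l.
    have py : (G (phiy chi (x k) (y k))) ^+ 2 - eta0 / 4 * `|q| ^+ 2 <=
       G (phiy chi (zetax chi (x k) (gx k) (gy k) t p) (zetay chi (y k) (gx k) (gy k) t p))
      * G (phiy chi (gx k) (gy k)).
      apply: prd.
      - by apply: norm_lin4_le => j; have [] := bd j _ _ (x2K k) (y2K k).
      - by apply: norm_lin4_le => j; have [] := bd j _ _ (gxK k) (gyK k).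
      - apply: Gd => j; have [_ _ h1 _] := hz j; apply: le_trans h1 _.
        by rewrite ler_pM2l.
      - apply: Gd => j; have [_ _ h1 _] := hg j; apply: le_trans h1 _.
        by rewrite ler_pM2l.
    apply: (le_trans _ (lerD px py)); rewrite /G.
    by rewrite le_eqVlt; apply/orP; left; apply/eqP; field.
  have := le_trans lo up; rewrite expr2 mulrA ler_pM2r //; clear; lra.
- move=> t p q d; apply: rV_norm_le; first by rewrite mulr_ge0.
  move=> i; rewrite motion_DE; apply: norm_mean_le => // k.
  have [b1 b2] := bd i _ _ (zxK t p k d) (zyK t p k d).
  apply: le_trans (ler_normD _ _) _; rewrite !normrM.
  apply: le_trans (lerD (ler_pM _ _ b1 (Vx k q)) (ler_pM _ _ b2 (Vy k q))) _ => //.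
  apply: (le_trans _ (ler_wpM2r (normr_ge0 q) k2)).
  by rewrite le_eqVlt; apply/orP; left; apply/eqP; ring.
- move=> s t p p' q ds dt; apply: rV_norm_le; first by rewrite !mulr_ge0.
  move=> i; rewrite rV_sub2E !motion_DE -mulrBr -sumrB; apply: norm_mean_le => // k.
  have [_ h1 h2 _] := hC i chi _ _ _ _ chi01 (zxK t p k dt) (zyK t p k dt)
     (zxK s p' k ds) (zyK s p' k ds).
  have hd := zd s t p p' k.
  have e (a b c d a' c' : R) : a * b + c * d - (a' * b + c' * d) =
    (a - a') * b + (c - c') * d by ring.
  rewrite e; apply: le_trans (ler_normD _ _) _; rewrite !normrM.
  have h1' := le_trans h1 (ler_wpM2l (ltW C0) hd).
  have h2' := le_trans h2 (ler_wpM2l (ltW C0) hd).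
  apply: le_trans (lerD (ler_pM _ _ h1' (Vx k q)) (ler_pM _ _ h2' (Vy k q))) _ => //.
  apply: (le_trans _ (ler_wpM2r (normr_ge0 q) (ler_wpM2r (u0 _ _ _ _) k3))).
  by rewrite le_eqVlt; apply/orP; left; apply/eqP; ring.
- move=> t p d; apply: rV_norm_le => // i; rewrite mxE; apply: norm_mean_le => // k.
  have [b1 b2] := bd i _ _ (zxK t p k d) (zyK t p k d).
  apply: le_trans (ler_normD _ _) _; rewrite !normrM; apply: (le_trans _ k4).
  apply: le_trans (lerD (ler_pM _ _ b1 (gx1 k)) (ler_pM _ _ b2 (gy1 k))) _ => //.
  lra.
- move=> s t p p' ds dt; apply: rV_norm_le; first by rewrite mulr_ge0.
  move=> i; rewrite rV_sub2E !mxE -mulrBr -sumrB; apply: norm_mean_le => // k.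
  have [_ h1 h2 _] := hC i chi _ _ _ _ chi01 (zxK t p k dt) (zyK t p k dt)
     (zxK s p' k ds) (zyK s p' k ds).
  have hd := zd s t p p' k.
  have e (a b c d a' c' : R) : a * b + c * d - (a' * b + c' * d) =
    (a - a') * b + (c - c') * d by ring.
  rewrite e; apply: le_trans (ler_normD _ _) _; rewrite !normrM.
  have h1' := le_trans h1 (ler_wpM2l (ltW C0) hd).
  have h2' := le_trans h2 (ler_wpM2l (ltW C0) hd).
  apply: le_trans (lerD (ler_pM _ _ h1' (gx1 k)) (ler_pM _ _ h2' (gy1 k))) _ => //.
  apply: (le_trans _ (ler_wpM2r (u0 _ _ _ _) k5)).
  by rewrite le_eqVlt; apply/orP; left; apply/eqP; ring.
- apply/rowP => i; rewrite !mxE.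
  have S0 (F : 'I_4 -> R) : \sum_j (0 : 'rV[R]_4) 0 j * F j = 0.
    by rewrite big1 // => j _; rewrite mxE mul0r.
  under eq_bigr do rewrite /zetax /zetay !S0 !mul0r !addr0.
  by rewrite mom mulr0.
- move=> t t01.
  have dom0 : ift_dom del t (0 : 'rV[R]_4) by rewrite /ift_dom t01 normr0 ltW.
  apply: le_lt_trans c3; apply: rV_norm_le; first by rewrite !mulr_ge0 // ltW.
  move=> i; rewrite mxE -[X in N%:R^-1 * X]subr0 -[X in _ - X](mom i) -sumrB.
  apply: norm_mean_le => // k.
  have [[b1 b2] _ _ T] := hC i chi _ _ _ _ chi01 (x2K k) (y2K k) (zxK _ _ k dom0) (zyK _ _ k dom0).
  have S0 (F : 'I_4 -> R) : \sum_j (0 : 'rV[R]_4) 0 j * F j = 0.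
    by rewrite big1 // => j _; rewrite mxE mul0r.
  have /andP[t0 t1] := t01.
  have hx : `|zetax chi (x k) (gx k) (gy k) t 0 - x k| <= eps.
    have -> : zetax chi (x k) (gx k) (gy k) t 0 - x k = t * (gx k - x k).
      by rewrite /zetax S0; ring.
    by rewrite normrM (ger0_norm t0); apply: (le_trans _ (gxe k)); rewrite ler_piMl.
  have hy : `|zetay chi (y k) (gx k) (gy k) t 0 - y k| <= eps.
    have -> : zetay chi (y k) (gx k) (gy k) t 0 - y k = t * (gy k - y k).
      by rewrite /zetay S0; ring.
    by rewrite normrM (ger0_norm t0); apply: (le_trans _ (gye k)); rewrite ler_piMl.
  move: T hx hy; move: (zetax _ _ _ _ _ _) (zetay _ _ _ _ _ _) => X Y T hx hy.
  have -> : phi chi X Y i - phi chi (x k) (y k) i =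
     (phi chi X Y i - phi chi (x k) (y k) i - phix chi (x k) (y k) i * (X - x k) -
      phiy chi (x k) (y k) i * (Y - y k)) + (phix chi (x k) (y k) i * (X - x k) +
      phiy chi (x k) (y k) i * (Y - y k)) by ring.
  apply: le_trans (ler_normD _ _) _.
  (* One factor is bounded by [2 eps], the other by [1]: the remainder stays linear in [eps], and
     with the gradient term the total is [4 C eps]. *)
  have d2 : (`|X - x k| + `|Y - y k|) ^+ 2 <= (2 * eps) * 1.
    rewrite expr2; apply: ler_pM; rewrite ?addr_ge0 //.
      by move: hx hy; clear; lra.
    by move: hx hy epsrho rho1; clear; lra.
  have T' := le_trans T (ler_wpM2l (ltW C0) d2).
  have g : `|phix chi (x k) (y k) i * (X - x k) + phiy chi (x k) (y k) i * (Y - y k)|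
      <= C * eps + C * eps.
    apply: le_trans (ler_normD _ _) _; rewrite !normrM.
    by apply: lerD; apply: ler_pM.
  by move: T' g; clear; lra.
Qed.

Lemma finite_grid (R : realType) (K eps : R) : 0 < K -> 0 < eps ->
  exists (g : R -> R) (s : seq R), (0 < size s)%N /\
    forall x, `|x| <= K -> `|g x - x| <= eps /\ g x \in s.
Proof.
move=> K0 eps0.
(* Rounding down to the grid of mesh [eps] that starts at [- K]; the [.+1] in the list below
   includes the node assigned to [x = K]. *)
pose f (n : nat) : R := eps * n%:R - K.
exists (fun x => f (Num.truncn ((x + K) / eps))).
exists [seq f n | n <- iota 0 (Num.truncn (2 * K / eps)).+1]; split.
  by rewrite size_map size_iota.
move=> x; rewrite ler_norml => /andP[x1 x2].
have xK : 0 <= x + K by lra.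
have /andP[t1 t2] := truncn_itv (divr_ge0 xK (ltW eps0)).
split; last first.
  apply: map_f; rewrite mem_iota /= add0n ltnS; apply: le_truncn.
  by rewrite ler_pM2r ?invr_gt0 //; lra.
move: t1 t2; rewrite ler_pdivlMr // ltr_pdivrMr //.
move: (Num.truncn _) => n; rewrite -natr1 mulrDl mul1r /f.
by rewrite ler_norml; lra.
Qed.

Lemma small_against3 (R : realType) (a b c : R) : 0 < a -> 0 < b -> 0 < c ->
  exists2 d : R, 0 < d & [/\ a * d <= 1, b * d <= 1 & c * d <= 1].
Proof.
move=> a0 b0 c0; have s0 : 0 < a + b + c by rewrite !addr_gt0.
exists (a + b + c)^-1; first by rewrite invr_gt0.
by split; rewrite ler_pdivrMr // mul1r; lra.
Qed.

(** The inequality [x^2 <= 2 X^2 + 2 (X - x)^2] and its analogue for [y] give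
    [X^2 + Y^2 >= 3 / (8 K^2)], which leaves room for the stated bound; the upper bound follows from
    [|X|, |Y| <= 2 K]. *)
Lemma annulus_perturb (R : realType) (K x y X Y : R) : 1 < K ->
  (K ^+ 2)^-1 <= x ^+ 2 + y ^+ 2 <= K ^+ 2 -> `|x| <= K -> `|y| <= K ->
  `|X - x| <= (4 * K)^-1 -> `|Y - y| <= (4 * K)^-1 ->
  (4 * K ^+ 2)^-1 <= X ^+ 2 + Y ^+ 2 <= 8 * K ^+ 2.
Proof.
move=> K1 /andP[ann _] xK yK hX hY; have K0 : 0 < K by lra.
have sq (a b : R) : `|a| <= b -> a ^+ 2 <= b ^+ 2.
  by move=> ab; rewrite -real_normK ?num_real // lerXn2r // nnegrE (le_trans _ ab).
have i4 : (4 * K)^-1 <= K.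
  by apply: (le_trans _ (ltW K1)); rewrite invf_le1 ?mulr_gt0 //; lra.
have e4 : ((4 * K)^-1) ^+ 2 = (K ^+ 2)^-1 / 16 by field; rewrite gt_eqF.
have e5 : (4 * K ^+ 2)^-1 = (K ^+ 2)^-1 / 4 by field; rewrite gt_eqF.
have X2 : `|X| <= 2 * K.
  by rewrite -[X](subrK x); apply: le_trans (ler_normD _ _) _; lra.
have Y2 : `|Y| <= 2 * K.
  by rewrite -[Y](subrK y); apply: le_trans (ler_normD _ _) _; lra.
have I0 : 0 < (K ^+ 2)^-1 by rewrite invr_gt0 exprn_gt0.
apply/andP; split.
  have := sq _ _ hX; have := sq _ _ hY; rewrite e4 e5 => qY qX.
  have hx := sqr_ge0 (2 * X - x); have hy := sqr_ge0 (2 * Y - y).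
  have : x ^+ 2 <= 2 * X ^+ 2 + 2 * (X - x) ^+ 2 by lra.
  have : y ^+ 2 <= 2 * Y ^+ 2 + 2 * (Y - y) ^+ 2 by lra.
  lra.
by have := sq _ _ X2; have := sq _ _ Y2; rewrite !exprMn; lra.
Qed.

Lemma real_path (R : realType) (K : R) : 1 < K ->
  exists (C : R) (M : nat), 0 < C /\ (0 < M)%N /\
  forall (chi : R) (N : nat) (x y : 'I_N -> R),
    0 <= chi <= 1 - K^-1 -> (0 < N)%N ->
    (forall k, (K ^+ 2)^-1 <= x k ^+ 2 + y k ^+ 2 <= K ^+ 2) ->
    (forall i, \sum_k phi chi (x k) (y k) i = 0) ->
  exists (X Y dX dY : R -> 'I_N -> R) (S : seq (R * R)),
    [/\ (size S <= M)%N, (forall k, X 0 k = x k /\ Y 0 k = y k),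
        (forall k, (X 1 k, Y 1 k) \in S) &
    forall s t, 0 <= s <= 1 -> 0 <= t <= 1 ->
      (forall i, \sum_k phi chi (X t k) (Y t k) i = 0) /\
      forall k, [/\ (4 * K ^+ 2)^-1 <= X t k ^+ 2 + Y t k ^+ 2 <= 8 * K ^+ 2,
        `|dX t k| <= C /\ `|dY t k| <= C,
        `|X s k - X t k - (s - t) * dX t k| <= C * `|s - t| ^+ 2,
        `|Y s k - Y t k - (s - t) * dY t k| <= C * `|s - t| ^+ 2 &
        `|dX s k - dX t k| <= C * `|s - t| /\ `|dY s k - dY t k| <= C * `|s - t| ]].
Proof.
move=> K1; have K0 : 0 < K by lra.
have [eta0 eta00 coer] := @phi_gram_coercive R K K1.
have [|C C0 hC] := @phi_smooth R (2 * K); first by rewrite mulr_gt0.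
have eta80 : 0 < eta0 / 8 by rewrite divr_gt0.
have Cc0 : 0 < ift_const C.
  by have [_ [_ _ _ h _]] := ift_const_ge C0; apply: lt_le_trans h; rewrite mulr_gt0.
have [C1 C10 ift] := quantitative_ift eta80 Cc0.
(* [del] is fixed before [eps]: the initial error of order [eps] must be small compared with the
   radius [del] in which the correction is sought. Each coefficient encodes one smallness condition
   of [quantitative_ift] or [phi_ift_data]. *)
have [||| del del0 [d1 d2 d3]] := @small_against3 R (32 * ift_const C / eta0)
  (32 * C * K) (16 * (16 * (8 * C ^+ 3)) / eta0).
- by apply: divr_gt0 => //; do !apply: mulr_gt0 => //.
- by rewrite !mulr_gt0.
- by apply: divr_gt0 => //; do !apply: mulr_gt0 => //; exact: exprn_gt0.
have [||| eps eps0 [e1 e2 e3]] := @small_against3 R (8 * K) (16 * (16 * (2 * C ^+ 2)) / eta0)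
  (16 * (16 * C) / (eta0 * del)).
- by rewrite mulr_gt0.
- by apply: divr_gt0 => //; do !apply: mulr_gt0 => //; exact: exprn_gt0.
- by apply: divr_gt0; do !apply: mulr_gt0 => //.
have {}d1 : 4 * ift_const C * del <= eta0 / 8.
  by move: d1; rewrite mulrAC ler_pdivrMr //; lra.
have {}d3 : 1024 * C ^+ 3 * del <= eta0 / 2.
  by move: d3; rewrite mulrAC ler_pdivrMr //; lra.
have {}e2 : 256 * C ^+ 2 * eps <= eta0 / 2.
  by move: e2; rewrite mulrAC ler_pdivrMr //; lra.
have ed0 : 0 < eta0 * del by rewrite mulr_gt0.
have {}e3 : 4 * C * eps < eta0 / 8 * del / 4.
  by move: e3; rewrite mulrAC ler_pdivrMr //; lra.
have {}e1 : eps <= (8 * K)^-1 by rewrite -[leRHS]mul1r ler_pdivlMr ?mulr_gt0 // mulrC.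
have {}d2 : 4 * C * del <= (8 * K)^-1.
  by rewrite -[leRHS]mul1r ler_pdivlMr ?mulr_gt0 //; lra.
have k8 : (8 * K)^-1 + (8 * K)^-1 = (4 * K)^-1 by field; rewrite gt_eqF.
have [g [G [G0 hG]]] := finite_grid K0 eps0.
(* The [1] bounds the speed of the straight motion, the other term that of the correction along the
   four gradients. *)
exists (1 + 4 * C * C1), (size G * size G)%N; split.
  by rewrite addr_gt0 // !mulr_gt0.
split; first by rewrite muln_gt0 G0.
move=> chi N x y chi01 N0 ann mom.
have chi1 : 0 <= chi <= 1.
  move: chi01 => /andP[-> h]; apply: le_trans h _.
  by rewrite lerBlDr lerDl invr_ge0 ltW.
have xK k : `|x k| <= K.
  rewrite -ler_sqr ?nnegrE ?(ltW K0) // real_normK ?num_real //.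
  by have /andP[_ h] := ann k; apply: le_trans h; rewrite lerDl sqr_ge0.
have yK k : `|y k| <= K.
  rewrite -ler_sqr ?nnegrE ?(ltW K0) // real_normK ?num_real //.
  by have /andP[_ h] := ann k; apply: le_trans h; rewrite lerDr sqr_ge0.
pose gx k := g (x k); pose gy k := g (y k).
have gxe k : `|gx k - x k| <= eps by have [] := hG _ (xK k).
have gye k : `|gy k - y k| <= eps by have [] := hG _ (yK k).
have data : ift_data (eta0 / 8) (ift_const C) del (motion_H chi x y gx gy)
    (motion_m chi x y gx gy) (motion_D chi x y gx gy).
  apply: (@phi_ift_data R K C eta0 chi eps del) => //.
  - exact: coer.
  - by rewrite -k8; lra.
  - lra.
have [p [dp [p0 hp]]] := ift _ _ _ _ _ del0 d1 data.
have K81 : (8 * K)^-1 <= 1 by rewrite invf_le1 ?mulr_gt0 //; lra.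
have gxK k : `|gx k| <= 2 * K.
  by rewrite -[gx k](subrK (x k)); apply: le_trans (ler_normD _ _) _;
    move: (gxe k) (xK k) e1 K81 K1; clear; lra.
have gyK k : `|gy k| <= 2 * K.
  by rewrite -[gy k](subrK (y k)); apply: le_trans (ler_normD _ _) _;
    move: (gye k) (yK k) e1 K81 K1; clear; lra.
have bx k j : `|phix chi (gx k) (gy k) j| <= C.
  by have [[]] := hC j chi _ _ _ _ chi1 (gxK k) (gyK k) (gxK k) (gyK k).
have by' k j : `|phiy chi (gx k) (gy k) j| <= C.
  by have [[]] := hC j chi _ _ _ _ chi1 (gxK k) (gyK k) (gxK k) (gyK k).
exists (fun t k => zetax chi (x k) (gx k) (gy k) t (p t)).
exists (fun t k => zetay chi (y k) (gx k) (gy k) t (p t)).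
exists (fun t k => gx k - x k + \sum_j (dp t) 0 j * phix chi (gx k) (gy k) j).
exists (fun t k => gy k - y k + \sum_j (dp t) 0 j * phiy chi (gx k) (gy k) j).
(* The endpoints are shifted grid points. Their positions vary with the data through [p 1]; only
   their number is bounded in terms of [K]. *)
exists [seq (a.1 + \sum_j (p 1) 0 j * phix chi a.1 a.2 j,
             a.2 + \sum_j (p 1) 0 j * phiy chi a.1 a.2 j) | a <- [seq (u, v) | u <- G, v <- G]].
split.
- by rewrite size_map size_allpairs.
- move=> k; rewrite /zetax /zetay p0 !mul0r !addr0.
  by rewrite !big1 ?addr0 // => j _; rewrite mxE mul0r.
- move=> k; apply/mapP; exists (gx k, gy k) => /=.
    by apply: allpairs_f; [have [] := hG _ (xK k)|have [] := hG _ (yK k)].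
  by rewrite /zetax /zetay !mul1r ![_ + (g _ - _)]addrC !subrK.
move=> s t s01 t01; have [h1 h2 h3 h4 h5] := hp s t s01 t01; split.
  move=> i; have := congr1 (fun v : 'rV[R]_4 => v 0 i) h2; rewrite !mxE => /eqP.
  by rewrite mulf_eq0 invr_eq0 pnatr_eq0 -leqn0 leqNgt N0 /= => /eqP.
move=> k; have dom : ift_dom del t (p t) by rewrite /ift_dom t01 h1.
have cx := zetax_close (ltW C0) (gxe k) (bx k) dom.
have cy := zetay_close (ltW C0) (gye k) (by' k) dom.
have linx (w : 'rV[R]_4) (c : R) : `|w| <= C1 * c -> 0 <= c ->
    `|\sum_j w 0 j * phix chi (gx k) (gy k) j| <= 4 * C * C1 * c.
  move=> h c0; apply: le_trans (norm_lin4_le _ (bx k)) _.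
  by rewrite -(mulrA _ C1) ler_wpM2l // mulr_ge0 // ltW.
have liny (w : 'rV[R]_4) (c : R) : `|w| <= C1 * c -> 0 <= c ->
    `|\sum_j w 0 j * phiy chi (gx k) (gy k) j| <= 4 * C * C1 * c.
  move=> h c0; apply: le_trans (norm_lin4_le _ (by' k)) _.
  by rewrite -(mulrA _ C1) ler_wpM2l // mulr_ge0 // ltW.
have up (a c : R) : 0 <= c -> a <= 4 * C * C1 * c -> a <= (1 + 4 * C * C1) * c.
  by move=> c0 h; rewrite mulrDl mul1r; apply: le_trans h _; rewrite lerDr.
have st0 := normr_ge0 (s - t).
have L3 (F : 'I_4 -> R) : \sum_j (p s - p t - (s - t) *: dp t) 0 j * F j =
    \sum_j p s 0 j * F j - \sum_j p t 0 j * F j - (s - t) * \sum_j dp t 0 j * F j.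
  by rewrite mulr_sumr -!sumrB; apply: eq_bigr => j _; rewrite !mxE; ring.
split.
- by apply: annulus_perturb (ann k) (xK k) (yK k) _ _;
    [exact: K1|apply: le_trans cx _|apply: le_trans cy _]; rewrite -k8 lerD.
- have gx1 : `|gx k - x k| <= 1 by move: (gxe k) e1 K81; clear; lra.
  have gy1 : `|gy k - y k| <= 1 by move: (gye k) e1 K81; clear; lra.
  split; apply: le_trans (ler_normD _ _) _; apply: lerD => //.
    by rewrite -[leRHS]mulr1; apply: linx => //; rewrite mulr1.
  by rewrite -[leRHS]mulr1; apply: liny => //; rewrite mulr1.
- apply: up; first by rewrite exprn_ge0.
  apply: le_trans (linx _ _ h4 _); last by rewrite exprn_ge0.
  rewrite le_eqVlt; apply/orP; left; apply/eqP; congr (`|_|); rewrite /zetax.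
  by rewrite L3; ring.
- apply: up; first by rewrite exprn_ge0.
  apply: le_trans (liny _ _ h4 _); last by rewrite exprn_ge0.
  rewrite le_eqVlt; apply/orP; left; apply/eqP; congr (`|_|); rewrite /zetay.
  by rewrite L3; ring.
- have e (a b c : R) : a + b - (a + c) = b - c by ring.
  split; apply: up => //; rewrite e -sumrB; under eq_bigr do rewrite -mulrBl -rV_sub2E.
    exact: linx.
  exact: liny.
Qed.

(** * Diagonal complex matrices *)

Definition dgmx {R : realType} {N : nat} (z : 'I_N -> R[i]) : 'M[R[i]]_N :=
  diag_mx (\row_k z k).

Lemma dgmxE (R : realType) (N : nat) (z : 'I_N -> R[i]) i j :
  dgmx z i j = z i *+ (i == j).
Proof. by rewrite !mxE. Qed.

Lemma dgmx_ext (R : realType) (N : nat) (z w : 'I_N -> R[i]) : z =1 w -> dgmx z = dgmx w.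
Proof. by move=> zw; congr diag_mx; apply/rowP => k; rewrite !mxE. Qed.

Lemma dgmxM (R : realType) (N : nat) (z w : 'I_N -> R[i]) :
  dgmx z *m dgmx w = dgmx (fun k => z k * w k).
Proof. by rewrite mulmx_diag; congr diag_mx; apply/rowP => k; rewrite !mxE. Qed.

Lemma dgmxX (R : realType) (N : nat) (z : 'I_N -> R[i]) n :
  dgmx z ^+ n = dgmx (fun k => z k ^+ n).
Proof.
elim: n => [|n IH].
  rewrite expr0; apply/matrixP => i j; rewrite dgmxE expr0 [LHS]mxE.
  by case: (i == j).
rewrite exprS IH -[_ * _]/(_ *m _) dgmxM; apply: dgmx_ext => k.
by rewrite exprS.
Qed.

Lemma dgmx_adj (R : realType) (N : nat) (z : 'I_N -> R[i]) :
  (dgmx z)^t* = dgmx (fun k => conjc (z k)).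
Proof.
apply/matrixP => i j; rewrite !mxE eq_sym.
by case: eqVneq => [->|_] //=; rewrite ?mulr1n // !mulr0n rmorph0.
Qed.

Lemma ntr_dgmx (R : realType) (N : nat) (z : 'I_N -> R[i]) :
  ntr (dgmx z) = N%:R^-1 * \sum_k z k.
Proof. by rewrite /ntr mxtrace_diag; under eq_bigr do rewrite mxE. Qed.

Lemma dgmx_diag (R : realType) (N : nat) (B : 'M[R[i]]_N) :
  is_diag_mx B -> B = dgmx (fun k => B k k).
Proof.
move=> /is_diag_mxP h; apply/matrixP => i j; rewrite dgmxE.
by case: eqVneq => [->|ij] //; rewrite mulr0n h.
Qed.

Lemma dgmx_unit (R : realType) (N : nat) (z : 'I_N -> R[i]) :
  dgmx z \in unitmx <-> forall k, z k != 0.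
Proof.
rewrite unitmxE det_diag unitfE; under eq_bigr do rewrite mxE.
split=> [/prodf_neq0 h k|h]; first exact: h.
by apply/prodf_neq0 => k _.
Qed.

Lemma dgmx_inv (R : realType) (N : nat) (z : 'I_N -> R[i]) :
  (forall k, z k != 0) -> invmx (dgmx z) = dgmx (fun k => (z k)^-1).
Proof.
move=> z0; have u : dgmx z \in unitmx by apply/dgmx_unit.
rewrite -[LHS]mulmx1.
have -> : 1%:M = dgmx z *m dgmx (fun k => (z k)^-1).
  rewrite dgmxM; apply/matrixP => i j; rewrite dgmxE mulfV // mxE.
  by case: (i == j).
by rewrite mulmxA mulVmx // mul1mx.
Qed.

(** [absmx] enters the statement through even powers only, so this identity gives access to it
    whatever unitary diagonalization is selected. *)
Lemma sqrtmx_sqr (R : realType) (N : nat) (A : 'M[R[i]]_N) :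
  A \is normalmx -> sqrtmx A *m sqrtmx A = A.
Proof.
move=> /orthomx_spectralP nA; rewrite {3}nA /sqrtmx.
rewrite -!mulmxA; congr (_ *m _).
rewrite (mulmxA (spectralmx A) (invmx _)) mulmxV ?spectral_unit // mul1mx.
rewrite mulmxA mulmx_diag; congr (diag_mx _ *m _); apply/rowP => k.
by rewrite !mxE -expr2 sqrtCK.
Qed.

Lemma absmx_dgmx (R : realType) (N : nat) (z : 'I_N -> R[i]) :
  absmx (dgmx z) ^+ 2 = dgmx (fun k => conjc (z k) * z k).
Proof.
rewrite expr2 -[_ * _]/(_ *m _) /absmx dgmx_adj dgmxM sqrtmx_sqr //.
apply/normalmxP; rewrite dgmx_adj !dgmxM; apply: dgmx_ext => k; exact: mulrC.
Qed.

Lemma normc_ge0 (R : realType) (z : R[i]) : 0 <= Normc.normc z.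
Proof. by case: z => a b; exact: sqrtr_ge0. Qed.

Lemma l2norm_dgmx_le (R : realType) (N : nat) (z : 'I_N -> R[i]) (c : R) x :
  0 <= c -> (forall k, Normc.normc (z k) <= c) -> l2norm x <= 1 ->
  l2norm (dgmx z *m x) <= c.
Proof.
move=> c0 h x1; apply: (le_trans _ (_ : c * l2norm x <= c)); last first.
  by rewrite -[leRHS]mulr1 ler_wpM2l.
have -> : c * l2norm x = Num.sqrt (c ^+ 2 * \sum_(i < N) Normc.normc (x i 0) ^+ 2).
  by rewrite sqrtrM ?sqr_ge0 // sqrtr_sqr ger0_norm.
rewrite /l2norm ler_wsqrtr // mulr_sumr; apply: ler_sum => i _.
rewrite mul_diag_mx !mxE Normc.normcM exprMn ler_wpM2r ?exprn_ge0 //.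
  exact: normc_ge0.
by rewrite lerXn2r // nnegrE normc_ge0.
Qed.

Lemma opnorm_dgmx_le (R : realType) (N : nat) (z : 'I_N -> R[i]) (c : R) :
  0 <= c -> (forall k, Normc.normc (z k) <= c) -> opnorm (dgmx z) <= c.
Proof.
move=> c0 h; apply: ge_sup.
  exists (l2norm (dgmx z *m 0)); exists 0 => //=.
  by rewrite /l2norm big1 ?sqrtr0 ?ler01 // => k _; rewrite mxE Normc.normc0 expr0n.
by move=> _ [x /= x1 <-]; exact: l2norm_dgmx_le.
Qed.

Lemma normc_le_opnorm (R : realType) (N : nat) (z : 'I_N -> R[i]) (k : 'I_N) :
  Normc.normc (z k) <= opnorm (dgmx z).
Proof.
pose e : 'cV[R[i]]_N := \col_i (i == k)%:R.
have l2e (w : R[i]) (v : 'cV[R[i]]_N) : (forall i, v i 0 = w *+ (i == k)) ->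
    l2norm v = Normc.normc w.
  move=> hv; rewrite /l2norm (bigD1 k) //= hv eqxx mulr1n big1 => [|i ik].
    by rewrite addr0 sqrtr_sqr ger0_norm // normc_ge0.
  by rewrite hv (negPf ik) mulr0n Normc.normc0 expr0n.
have <- : l2norm (dgmx z *m e) = Normc.normc (z k).
  apply: l2e => i; rewrite mul_diag_mx !mxE.
  by case: eqVneq => [->|_]; rewrite ?mulr1 // mulr0.
apply: ub_le_sup; last first.
  exists e => //=; rewrite (l2e 1) ?Normc.normc1 // => i; rewrite mxE.
  by case: (i == k).
(* [ub_le_sup] requires the set of norms to be bounded above; a crude bound suffices. *)
exists (\sum_i Normc.normc (z i)).
move=> _ [x /= x1 <-]; apply: l2norm_dgmx_le => //.
  by rewrite sumr_ge0 // => i _; exact: normc_ge0.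
move=> i; rewrite (bigD1 i) //= lerDl sumr_ge0 // => j _; exact: normc_ge0.
Qed.

(** The selected diagonalization may reorder the entries, so the eigenvalue is located among the
    [z l] without fixing its index. *)
Lemma spectral_diag_dgmx (R : realType) (N : nat) (z : 'I_N -> R[i]) (k : 'I_N) :
  exists l, spectral_diag (dgmx z) 0 k = z l.
Proof.
set P := spectralmx (dgmx z); set d := spectral_diag (dgmx z).
have nz : dgmx z \is normalmx.
  by apply/normalmxP; rewrite dgmx_adj !dgmxM; apply: dgmx_ext => j; exact: mulrC.
have /orthomx_spectralP := nz; rewrite -/P -/d => E.
have PE : P *m dgmx z = diag_mx d *m P.
  by rewrite E -[invmx P *m _ *m _]mulmxA [LHS]mulmxA mulmxV ?spectral_unit // mul1mx.
(* row [k] of [P] is a nonzero left eigenvector for [d k] *)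
have [l Pl] : exists l, P k l != 0.
  apply/existsP; apply: contraT; rewrite negb_exists => /forallP h.
  have : row k P = 0 by apply/rowP => l; rewrite !mxE; apply/eqP; have := h l; rewrite negbK.
  move=> r0; have := congr1 (fun M => row k M) (mulmxV (spectral_unit (dgmx z))).
  rewrite row_mul -/P r0 mul0mx => /rowP/(_ k)/eqP.
  by rewrite !mxE eqxx eq_sym oner_eq0.
exists l; have := congr1 (fun A : 'M[R[i]]_N => A k l) PE.
rewrite mul_mx_diag mul_diag_mx !mxE mulrC => /(mulIf Pl) ->.
by [].
Qed.

Lemma spectral_measure_dgmx (R : realType) (N : nat) (z : 'I_N -> R[i]) (S : seq R[i])
    (M : nat) : (size S <= M)%N -> (forall k, z k \in S) ->
  supported_on_at_most (spectral_measure (dgmx z)) M.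
Proof.
move=> SM zS; exists S => //.
rewrite /spectral_measure /= /mscale /= /msum big1 ?mule0 // => k _.
rewrite /= /dirac indicE memNset //= => h; apply: h.
rewrite (nth_map k) ?size_enum_ord // nth_ord_enum.
by have [l ->] := spectral_diag_dgmx z k; exact: zS.
Qed.

Lemma normc_le_add (R : realType) (u v : R) : Normc.normc (u +i* v) <= `|u| + `|v|.
Proof.
rewrite /= -[leRHS](ger0_norm (addr_ge0 (normr_ge0 u) (normr_ge0 v))) -sqrtr_sqr.
rewrite ler_wsqrtr // sqrrD !real_normK ?num_real //.
by have : 0 <= `|u| * `|v| by []; lra.
Qed.

(** The radius [e] of a ball lies in [R[i]]; in the partial order [0 < e] forces it to be real,
    which reduces the claim to real parts. *)
Lemma complex_norm_lt (R : realType) (u v : R) (e : R[i]) : 0 < e ->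
  `|u| + `|v| < complex.Re e -> `|u +i* v| < e.
Proof.
move=> e0 h; move: e0; rewrite !ltcE /= => /andP[/eqP -> _]; rewrite eqxx /=.
exact: le_lt_trans (normc_le_add u v) h.
Qed.

Lemma dgmx_ball (R : realType) (N : nat) (u v u' v' : 'I_N -> R) (e : R[i]) :
  0 < e -> (forall k, `|u k - u' k| + `|v k - v' k| < complex.Re e) ->
  ball (dgmx (fun k => u k +i* v k)) e (dgmx (fun k => u' k +i* v' k)).
Proof.
move=> e0 h; split => // i j.
suff : `|dgmx (fun k => u k +i* v k) i j - dgmx (fun k => u' k +i* v' k) i j| < e by [].
rewrite !dgmxE -mulrnBl; case: (i == j); last by rewrite mulr0n normr0.
by rewrite mulr1n; apply: complex_norm_lt.
Qed.

Lemma C1_dgmx (R : realType) (N : nat) (C : R) (X Y dX dY : R -> 'I_N -> R) :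
  0 < C ->
  (forall s t, 0 <= s <= 1 -> 0 <= t <= 1 -> forall k,
      [/\ `|X s k - X t k - (s - t) * dX t k| <= C * `|s - t| ^+ 2,
          `|Y s k - Y t k - (s - t) * dY t k| <= C * `|s - t| ^+ 2 &
          `|dX s k - dX t k| <= C * `|s - t| /\ `|dY s k - dY t k| <= C * `|s - t| ]) ->
  C1_on01 (fun t => dgmx (fun k => X t k +i* Y t k))
          (fun t => dgmx (fun k => dX t k +i* dY t k)).
Proof.
move=> C0 h; split.
  move=> t; rewrite in_itv /= => t01; apply/cvg_ballP => e e0.
  have re0 : 0 < complex.Re e by move: e0; rewrite ltcE => /andP[].
  (* The real and the imaginary part each contribute an error [C * |s - t|], hence [2 * C]. *)
  have d0 : 0 < complex.Re e / (2 * C) by rewrite divr_gt0 // mulr_gt0.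
  have nb : \forall s \near t, `|t - s| < complex.Re e / (2 * C).
    by apply: (@cvgr_dist_lt _ _ _ (nbhs t) _ id t cvg_id).
  near=> s.
  have s01 : 0 <= s <= 1.
    by have : s \in `[0, 1]; [near: s; exact: withinT|rewrite in_itv].
  have st : s != t by near: s; apply: cvg_within; exact: withinT.
  have stC : 2 * C * `|s - t| < complex.Re e.
    rewrite mulrC -ltr_pdivlMr ?mulr_gt0 // distrC.
    by near: s; apply: cvg_within; apply: (cvg_within _ nb).
  have st0 : s - t != 0 by rewrite subr_eq0.
  have -> : (s - t)^-1%:C *: (dgmx (fun k => X s k +i* Y s k) - dgmx (fun k => X t k +i* Y t k)) =
    dgmx (fun k => ((s - t)^-1 * (X s k - X t k)) +i* ((s - t)^-1 * (Y s k - Y t k))).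
    have linE (c : R[i]) (A B : 'M[R[i]]_N) i j : (c *: (A - B)) i j = c * (A i j - B i j).
      by rewrite !mxE.
    apply/matrixP => i j; rewrite linE !dgmxE -mulrnBl mulrnAr; congr (_ *+ _).
    apply/eqP.
    by rewrite eq_complex /= !(mul0r, subr0, addr0) !eqxx.
  apply: dgmx_ball => // k; have [h1 h2 _] := h s t s01 t01 k.
  have q (a b d : R) : `|a - b - (s - t) * d| <= C * `|s - t| ^+ 2 ->
      `|d - (s - t)^-1 * (a - b)| <= C * `|s - t|.
    move=> ab; have -> : d - (s - t)^-1 * (a - b) = - (s - t)^-1 * (a - b - (s - t) * d).
      by field.
    rewrite normrM normrN normfV mulrC ler_pdivrMr ?normr_gt0 //.
    by rewrite -mulrA -expr2.
  apply: le_lt_trans (lerD (q _ _ _ h1) (q _ _ _ h2)) _; lra.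
apply/subspace_continuousP => t; rewrite /= in_itv /= => t01.
apply/cvg_ballP => e e0.
have re0 : 0 < complex.Re e by move: e0; rewrite ltcE => /andP[].
have d0 : 0 < complex.Re e / (2 * C) by rewrite divr_gt0 // mulr_gt0.
have nb : \forall s \near t, `|t - s| < complex.Re e / (2 * C).
  by apply: (@cvgr_dist_lt _ _ _ (nbhs t) _ id t cvg_id).
near=> s.
have s01 : 0 <= s <= 1.
  by have : s \in `[0, 1]; [near: s; exact: withinT|rewrite in_itv].
have stC : 2 * C * `|s - t| < complex.Re e.
  rewrite mulrC -ltr_pdivlMr ?mulr_gt0 // distrC.
  by near: s; apply: (cvg_within _ nb).
apply: dgmx_ball => // k; have [_ _ [h1 h2]] := h s t s01 t01 k.
rewrite distrC (distrC (dY t k)); apply: le_lt_trans (lerD h1 h2) _; lra.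
Unshelve. all: by end_near. Qed.

(** * The trace conditions as four real equations *)

Lemma normc_sqr (R : realType) (z : R[i]) :
  Normc.normc z ^+ 2 = complex.Re z ^+ 2 + complex.Im z ^+ 2.
Proof. by case: z => a b; rewrite sqr_sqrtr // addr_ge0 ?sqr_ge0. Qed.

Lemma Re_sum (R : realType) (I : finType) (F : I -> R[i]) :
  complex.Re (\sum_k F k) = \sum_k complex.Re (F k).
Proof.
apply: (big_morph (@complex.Re R)) => //= -[a b] [c d] //.
Qed.

Lemma Im_sum (R : realType) (I : finType) (F : I -> R[i]) :
  complex.Im (\sum_k F k) = \sum_k complex.Im (F k).
Proof.
apply: (big_morph (@complex.Im R)) => //= -[a b] [c d] //.
Qed.

Lemma mean_eq0 (R : realType) (N : nat) (F : 'I_N -> R[i]) : (0 < N)%N ->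
  N%:R^-1 * \sum_k F k = 0 <->
  \sum_k complex.Re (F k) = 0 /\ \sum_k complex.Im (F k) = 0.
Proof.
move=> N0; rewrite -Re_sum -Im_sum; split=> [/eqP|[r0 i0]].
  rewrite mulf_eq0 invr_eq0 pnatr_eq0 -leqn0 leqNgt N0 /= => /eqP ->.
  by [].
rewrite [X in _ * X](_ : _ = 0) ?mulr0 //; apply/eqP.
by rewrite eq_complex r0 i0 /= eqxx.
Qed.

(** The parameter [c] is free because the components [0] and [1] of [phi] do not involve it. *)
Lemma ntr_cubic_eq0 (R : realType) (N : nat) (x y : 'I_N -> R) (c : R) : (0 < N)%N ->
  let B := dgmx (fun k => x k +i* y k) in
  ntr (B ^+ 2 *m B^t*) = 0 <->
  \sum_k phi c (x k) (y k) 0 = 0 /\ \sum_k phi c (x k) (y k) 1 = 0.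
Proof.
move=> N0 B; pose F k := (x k +i* y k) ^+ 2 * conjc (x k +i* y k).
have -> : ntr (B ^+ 2 *m B^t*) = N%:R^-1 * \sum_k F k.
  by rewrite dgmxX dgmx_adj dgmxM ntr_dgmx.
rewrite (mean_eq0 F N0).
have eR : \sum_k complex.Re (F k) = \sum_k phi c (x k) (y k) 0.
  by apply: eq_bigr => k _; rewrite /F /phi /= expr2 /=; ring.
have eI : \sum_k complex.Im (F k) = \sum_k phi c (x k) (y k) 1.
  by apply: eq_bigr => k _; rewrite /F /phi /= expr2 /=; ring.
by rewrite eR eI.
Qed.

Lemma ntr_quartic_eq0 (R : realType) (N : nat) (x y : 'I_N -> R) (c : R) : (0 < N)%N ->
  let B := dgmx (fun k => x k +i* y k) in
  ntr (B ^+ 3 *m B^t*) - c%:C * ntr (absmx B ^+ 4) = 0 <->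
  \sum_k phi c (x k) (y k) 2 = 0 /\ \sum_k phi c (x k) (y k) 3 = 0.
Proof.
move=> N0 B; pose F k : R[i] := (x k +i* y k) ^+ 3 * conjc (x k +i* y k)
  - c%:C * (conjc (x k +i* y k) * (x k +i* y k)) ^+ 2.
have -> : ntr (B ^+ 3 *m B^t*) - c%:C * ntr (absmx B ^+ 4) = N%:R^-1 * \sum_k F k.
  rewrite -[4%N]/(2 * 2)%N exprM absmx_dgmx !dgmxX dgmx_adj dgmxM !ntr_dgmx.
  by rewrite mulrCA -mulrBr mulr_sumr -sumrB.
rewrite (mean_eq0 F N0).
have eR : \sum_k complex.Re (F k) = \sum_k phi c (x k) (y k) 3.
  by apply: eq_bigr => k _; rewrite /F /phi /= exprS !expr2 /=; ring.
have eI : \sum_k complex.Im (F k) = 2 * \sum_k phi c (x k) (y k) 2.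
  rewrite mulr_sumr.
  by apply: eq_bigr => k _; rewrite /F /phi /= exprS !expr2 /=; ring.
rewrite eR eI; split=> [[-> /eqP]|[-> ->]]; last by rewrite mulr0.
by rewrite mulf_eq0 pnatr_eq0 /= => /eqP ->.
Qed.

Lemma absmx_sqr_sqr (R : realType) (N : nat) (z : 'I_N -> R[i]) :
  absmx (dgmx z ^+ 2) ^+ 2 = absmx (dgmx z) ^+ 4.
Proof.
transitivity ((absmx (dgmx z) ^+ 2) ^+ 2); last by rewrite -exprM.
rewrite dgmxX [LHS]absmx_dgmx (absmx_dgmx z) dgmxX; apply: dgmx_ext => k.
by rewrite rmorphXn exprMn.
Qed.

Lemma complex_sqr_norm_gt0 (R : realType) (z : R[i]) : z != 0 ->
  0 < complex.Re ((conjc z * z) ^+ 2).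
Proof.
case: z => a b z0; have ab := z0; rewrite eq_complex /= in ab.
have -> : complex.Re ((conjc (a +i* b) * (a +i* b)) ^+ 2) = (a ^+ 2 + b ^+ 2) ^+ 2.
  by rewrite expr2 /=; ring.
by rewrite exprn_even_gt0 //= paddr_eq0 ?sqr_ge0 // !sqrf_eq0.
Qed.

Lemma ntr_absmx_neq0 (R : realType) (N : nat) (z : 'I_N -> R[i]) : (0 < N)%N ->
  (forall k, z k != 0) -> ntr (absmx (dgmx z) ^+ 4) != 0.
Proof.
move=> N0 z0; have -> : ntr (absmx (dgmx z) ^+ 4) = N%:R^-1 * \sum_k (conjc (z k) * z k) ^+ 2.
  by rewrite -[4%N]/(2 * 2)%N exprM absmx_dgmx dgmxX ntr_dgmx.
apply/eqP => /(mean_eq0 _ N0) [+ _]; apply/eqP; rewrite gt_eqF //.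
have pos k := complex_sqr_norm_gt0 (z0 k).
rewrite (bigD1 (Ordinal N0)) //=; apply: ltr_pwDl; first exact: pos.
by apply: sumr_ge0 => k _; exact/ltW/pos.
Qed.

(** Nonzero entries make the denominator of [chi] nonzero, and for diagonal matrices that
    denominator is [ntr (absmx B ^+ 4)]; the quotient and the polynomial form of (v') then agree. *)
Lemma chi_eq (R : realType) (N : nat) (z : 'I_N -> R[i]) (c : R) : (0 < N)%N ->
  (forall k, z k != 0) ->
  let B := dgmx z in
  chi B = c%:C <-> ntr (B ^+ 3 *m B^t*) - c%:C * ntr (absmx B ^+ 4) = 0.
Proof.
move=> N0 z0 B; have D0 := ntr_absmx_neq0 N0 z0.
have -> : chi B = ntr (B ^+ 3 *m B^t*) / ntr (absmx B ^+ 4).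
  by rewrite -(absmx_sqr_sqr z).
move: D0; rewrite -/B.
move: (ntr (absmx B ^+ 4)) (ntr (B ^+ 3 *m _)) => D A D0.
split=> [<-|/eqP]; first by rewrite mulfVK // subrr.
by rewrite subr_eq0 => /eqP ->; rewrite mulfK.
Qed.

Unset Implicit Arguments.

Theorem proposition5p2 (R : realType) (K : R) (hK : 1 < K) :
  exists (K1 : R) (M : nat), 0 < K1 /\ (0 < M)%N /\
    forall (N : nat) (B : 'M[R[i]]_N), (0 < N)%N ->
      is_diag_mx B ->
      B \in unitmx -> opnorm B <= K -> opnorm (invmx B) <= K ->
      ntr (B ^+ 2 *m B^t*) = 0 ->
      0 <= chi B -> chi B <= (1 - K^-1)%:C ->
      exists Bt dBt : R -> 'M[R[i]]_N,
        [/\ C1_on01 Bt dBt,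
            Bt 0 = B,
            supported_on_at_most (spectral_measure (Bt 1)) M &
            forall t : R, 0 <= t <= 1 ->
              is_diag_mx (Bt t) /\
              [/\ Bt t \in unitmx, opnorm (Bt t) <= K1 &
                  opnorm (invmx (Bt t)) <= K1] /\
              opnorm (dBt t) <= K1 /\
              ntr (Bt t ^+ 2 *m (Bt t)^t*) = 0 /\
              chi (Bt t) = chi B /\
              ntr (Bt t ^+ 3 *m (Bt t)^t*) - chi B * ntr (absmx (Bt t) ^+ 4)
                = 0].
Proof.
have K0 : 0 < K by lra.
have [C [M [C0 [M0 path]]]] := real_path hK.
have k3 : 3 * K <= 3 * K + 2 * C by lra.
have k2 : 2 * K <= 3 * K + 2 * C by lra.
have kC : C + C <= 3 * K + 2 * C by lra.
have k8 : 8 * K ^+ 2 <= (3 * K) ^+ 2 by nra.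
have K10 : 0 <= 3 * K + 2 * C by lra.
(* [3 * K] dominates the norm bound [sqrt 8 * K] and the bound [2 * K] for the inverse, both read
   off the enlarged annulus; [2 * C] dominates the sum of the two components of the derivative. *)
exists (3 * K + 2 * C), M; split; first by rewrite addr_gt0 // mulr_gt0.
split => // N B N0 Bdiag Bunit BK BiK cubic chi_ge chi_le.
pose x k := complex.Re (B k k); pose y k := complex.Im (B k k).
have BE : B = dgmx (fun k => x k +i* y k).
  by rewrite (dgmx_diag Bdiag); apply: dgmx_ext => k; rewrite /x /y; case: (B k k).
have z0 k : x k +i* y k != 0 by move: k; apply/dgmx_unit; rewrite -BE.
pose c := complex.Re (chi B).
(* The partial order compares only numbers with a real difference, so [0 <= chi B] makes [chi B]
   real. *)
have chiE : chi B = c%:C.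
  move: chi_ge; rewrite lecE /= => /andP[/eqP im0 _].
  by apply/eqP; rewrite eq_complex im0 /= !eqxx.
have c01 : 0 <= c <= 1 - K^-1.
  move: chi_ge chi_le; rewrite chiE !lecE /= => /andP[_ ->] /andP[_ h] //.
have ann k : (K ^+ 2)^-1 <= x k ^+ 2 + y k ^+ 2 <= K ^+ 2.
  have nz : Normc.normc (x k +i* y k) ^+ 2 = x k ^+ 2 + y k ^+ 2 by rewrite normc_sqr.
  have n0 : 0 < Normc.normc (x k +i* y k).
    rewrite lt_neqAle normc_ge0 andbT eq_sym; apply: contra (z0 k) => /eqP.
    by move=> /Normc.eq0_normc /eqP.
  rewrite -nz; apply/andP; split.
    rewrite -exprVn lerXn2r // ?nnegrE ?normc_ge0 ?invr_ge0 ?(ltW K0) //.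
    have := le_trans (normc_le_opnorm (fun k => (x k +i* y k)^-1) k) _.
    rewrite -dgmx_inv // -BE => /(_ _ BiK); rewrite Normc.normcV => h.
    by rewrite -[leRHS]invrK lef_pV2 ?posrE ?invr_gt0.
  rewrite lerXn2r // ?nnegrE ?normc_ge0 ?(ltW K0) //.
  by apply: le_trans BK; rewrite BE; exact: (normc_le_opnorm (fun k => x k +i* y k)).
have i4 (P : 'I_4 -> Prop) : P 0 -> P 1 -> P 2 -> P 3 -> forall i, P i.
  move=> p0 p1 p2 p3 [[|[|[|[|//]]]] h].
  - by rewrite (_ : Ordinal h = 0) //; apply: val_inj.
  - by rewrite (_ : Ordinal h = 1) //; apply: val_inj.
  - by rewrite (_ : Ordinal h = 2) //; apply: val_inj.
  - by rewrite (_ : Ordinal h = 3) //; apply: val_inj.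
have mom i : \sum_k phi c (x k) (y k) i = 0.
  have cubic' : ntr (dgmx (fun k => x k +i* y k) ^+ 2
      *m (dgmx (fun k => x k +i* y k))^t*) = 0 by rewrite -BE.
  have [m0 m1] := (ntr_cubic_eq0 _ _ c N0).1 cubic'.
  have ch : chi (dgmx (fun k => x k +i* y k)) = c%:C by rewrite -BE.
  have [m2 m3] := (ntr_quartic_eq0 _ _ c N0).1 ((chi_eq c N0 z0).1 ch).
  by apply: (i4 (fun i => \sum_k phi c (x k) (y k) i = 0)).
have [X [Y [dX [dY [S [SM start stop h]]]]]] := path c N _ _ c01 N0 ann mom.
exists (fun t => dgmx (fun k => X t k +i* Y t k)).
exists (fun t => dgmx (fun k => dX t k +i* dY t k)).
split.
- apply: (C1_dgmx C0) => s t s01 t01 k.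
  by have [_ /(_ k) [_ _ ? ? ?]] := h s t s01 t01.
- by rewrite BE; apply: dgmx_ext => k; have [-> ->] := start k.
- apply: (@spectral_measure_dgmx _ _ _ [seq a.1 +i* a.2 | a <- S]).
    by rewrite size_map.
  by move=> k; apply/mapP; exists (X 1 k, Y 1 k).
move=> t t01; have [momt ht] := h t t t01 t01.
have zt0 k : X t k +i* Y t k != 0.
  have [/andP[lo _] _ _ _ _] := ht k.
  apply: contraTneq lo => -[-> ->]; rewrite expr0n /= addr0 -ltNge.
  by rewrite invr_gt0 mulr_gt0 // exprn_gt0.
have quart := (ntr_quartic_eq0 _ _ c N0).2 (conj (momt 2) (momt 3)).
have nub k : Normc.normc (X t k +i* Y t k) <= 3 * K.
  have [/andP[_ up] _ _ _ _] := ht k.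
  rewrite -(ler_pXn2r (ltn0Sn 1)) ?nnegrE ?normc_ge0 ?mulr_ge0 ?(ltW K0) //.
  by rewrite normc_sqr; exact: le_trans up k8.
have nlb k : (2 * K)^-1 <= Normc.normc (X t k +i* Y t k).
  have [/andP[lo _] _ _ _ _] := ht k.
  rewrite -(ler_pXn2r (ltn0Sn 1)) ?nnegrE ?normc_ge0 ?invr_ge0 ?mulr_ge0 ?(ltW K0) //.
  rewrite normc_sqr /= exprVn exprMn; apply: le_trans lo.
  by rewrite le_eqVlt; apply/orP; left; apply/eqP; congr (_^-1); ring.
split; first exact: diag_mx_is_diag.
split.
  split; first exact/dgmx_unit.
  - apply: opnorm_dgmx_le => // k; exact: le_trans (nub k) k3.
  - rewrite dgmx_inv //; apply: opnorm_dgmx_le => // k.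
    rewrite Normc.normcV; apply: (le_trans _ k2).
    rewrite -[leRHS]invrK lef_pV2 ?posrE ?invr_gt0 ?mulr_gt0 //.
    by apply: lt_le_trans (nlb k); rewrite invr_gt0 mulr_gt0.
split.
  apply: opnorm_dgmx_le => // k; apply: le_trans (normc_le_add _ _) _.
  by have [_ [d1 d2] _ _ _] := ht k; exact: le_trans (lerD d1 d2) kC.
split; first exact: (ntr_cubic_eq0 _ _ c N0).2 (conj (momt 0) (momt 1)).
rewrite chiE; split; last exact: quart.
exact: (chi_eq c N0 zt0).2 quart.
Qed.
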